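(* Let $c_\alpha,c_z\ge0$, $\ell_c>0$, $\ell_J,\tilde\ell_J\ge0$ and $c_0>0$ be constants. Assume: (i) $|b(\alpha,z)-b(\alpha',z')|^2\le c_\alpha|\alpha-\alpha'|^2+c_z|z-z'|^2$ for all $(\alpha,z),(\alpha',z')\in A\times\mathbb{R}$, and $\mathbb{E}[\xi_0^2]<\infty$; (ii) $|\tilde{\mathcal{J}}(\alpha,\nu')-\tilde{\mathcal{J}}(\alpha,\nu)|\le\tilde\ell_J W_2(\nu,\nu')$ for all $\alpha\in A$, $\nu,\nu'\in\mathcal{K}$; (iii) for each $z\in\mathbb{R}$, $\alpha\mapsto\mathcal{J}(\alpha,z)$ is continuously differentiable on $A$ and, for all $\alpha,\alpha'\in A$, $z\in\mathbb{R}$, $\epsilon\in[0,1]$, $\mathcal{J}(\epsilon\alpha+(1-\epsilon)\alpha',z)\le\epsilon\mathcal{J}(\alpha,z)+(1-\epsilon)\mathcal{J}(\alpha',z)-\frac{\ell_c}{2}\epsilon(1-\epsilon)|\alpha-\alpha'|^2$; and $|\partial_\alpha\mathcal{J}(\alpha,z')-\partial_\alpha\mathcal{J}(\alpha,z)|\le\ell_J|z'-z|$ for all $\alpha\in A$, $z,z'\in\mathbb{R}$; (iv) $|b(\alpha,z)|\le c_0$ for all $\alpha\in A$, $z\in\mathbb{R}$. Let $(W^N)_{N\ge1}$ be a sequence of symmetric matrices $W^N\in\mathbb{R}^{N\times N}$, and suppose that for each $N\ge1$ there exists a unique Nash equilibrium $\boldsymbol{\alpha}^{N,*}\in A^N$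 for the $N$-player game with interaction matrix $W^N$. Let $w^N=\Psi^N(W^N)$, with graphon operator $\mathbf{W}^N$. Suppose there is a graphon $w$ with graphon operator $\mathbf{W}$ such that $\lim_{N\to\infty}\delta_\square(w^N,w)=0$, $\lim_{N\to\infty}\|w^N\|_2=\|w\|_2$, $\lim_{N\to\infty}\|\mathbf{W}^N\|=\|\mathbf{W}\|$, $\sqrt{2c_z}\,\|w\|_2<1$, $\sqrt{c_z}\,\|\mathbf{W}\|<1$ and $\frac{\ell_J}{\ell_c}\cdot\frac{\sqrt{c_\alpha}\|\mathbf{W}\|}{1-\sqrt{c_z}\|\mathbf{W}\|}<1$. Let $\hat{\boldsymbol{\alpha}}$ be the unique Nash equilibrium for the graphon game with graphon $w$. Then $$\lim_{N\to\infty}d_{\mathcal{S}}\bigl(\psi^N(\boldsymbol{\alpha}^{N,*}),\hat{\boldsymbol{\alpha}}\bigr)=0.$$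
   Context: Data. $I=[0,1]$ with Lebesgue measure; $L^2(I)$ is the usual real Lebesgue space. $A\subset\mathbb{R}$ is a nonempty closed convex set of actions, $\mathbb{A}=\{\boldsymbol{\alpha}\in L^2(I):\boldsymbol{\alpha}\text{ takes values in }A\}$. $\mu_0$ is a mean-zero probability measure on $\mathbb{R}$, $\xi_0\sim\mu_0$; $b:A\times\mathbb{R}\to\mathbb{R}$, $f:\mathbb{R}\times A\times\mathbb{R}\to\mathbb{R}$. $\mathcal{K}$ is the set of probability measures on $\mathbb{R}\times\mathbb{R}$ with first marginal $\mu_0$; for $\alpha\in A,\nu\in\mathcal{K}$, $\tilde{\mathcal{J}}(\alpha,\nu)=\int f(b(\alpha,z)+\xi,\alpha,z)\,\nu(d\xi,dz)$ (assumed well defined), and $\mathcal{J}(\alpha,z)=\tilde{\mathcal{J}}(\alpha,\mu_0\otimes\delta_z)=\mathbb{E}[f(b(\alpha,z)+\xi_0,\alpha,z)]$. $W_2$ is the 2-Wasserstein distance. $N$-player game with symmetric interaction matrix $W\in\mathbb{R}^{N\times N}$: $\xi_1,\dots,\xi_N$ are i.i.d. with law $\mu_0$ on a probability space $\Omega$. For $\boldsymbol{\alpha}\in A^N$, $\mathbf{Z}_N\boldsymbol{\alpha}=\mathbf{z}\in L^2(\Omega;\mathbb{R}^N)$ is the unique solution of $z_i=\frac1N\sum_{j=1}^N W_{i,j}[b(\alpha_j,z_j)+\xi_j]$, $i=1,\dots,N$ (existence and uniqueness of the aggregate is part of the game being well posed; it holds when $c_z\frac1{N^2}\sum_{i,j}W_{i,j}^2<1$).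 Player $i$ has cost $J_i(\boldsymbol{\alpha})=\mathbb{E}[f(b(\alpha_i,z_i)+\xi_i,\alpha_i,z_i)]=\tilde{\mathcal{J}}(\alpha_i,\mathcal{L}(\xi_i,[\mathbf{Z}_N\boldsymbol{\alpha}]_i))$, with $\mathcal{L}$ denoting the joint law. $\hat{\boldsymbol{\alpha}}\in A^N$ is a Nash equilibrium if $J_i(\hat{\boldsymbol{\alpha}})\le J_i([\beta;\hat{\boldsymbol{\alpha}}_{-i}])$ for all $i$ and $\beta\in A$, where $[\beta;\hat{\boldsymbol{\alpha}}_{-i}]$ is $\hat{\boldsymbol{\alpha}}$ with $i$-th entry replaced by $\beta$. Graphon game: a graphon is a symmetric Borel measurable square-integrable $w:I\times I\to\mathbb{R}$, with norm $\|w\|_2$ in $L^2(I\times I)$ and operator $[\mathbf{W}g]_x=\int_I w(x,y)g(y)\,dy$ on $L^2(I)$ with operator norm $\|\mathbf{W}\|$. If $\sqrt{c_z}\|\mathbf{W}\|<1$, for $\boldsymbol{\alpha}\in\mathbb{A}$ let $\mathbf{Z}\boldsymbol{\alpha}$ be the unique $\mathbf{z}\in L^2(I)$ with $z_x=\int_I w(x,y)b(\alpha_y,z_y)\,dy$ for a.e. $x$. A Nash equilibrium is $\hat{\boldsymbol{\alpha}}\in\mathbb{A}$ such that for a.e. $x$, $\mathcal{J}(\hat\alpha_x,[\mathbf{Z}\hat{\boldsymbol{\alpha}}]_x)\le\mathcal{J}(\beta,[\mathbf{Z}\hat{\boldsymbol{\alpha}}]_x)$ for all $\beta\in A$; under the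 stated conditions on $w$ it exists and is unique. Notation: $\psi^N(\boldsymbol{\alpha})_x=\alpha_i$ for $x\in[(i-1)/N,i/N)$; $\Psi^N(W)(x,y)=W_{i,j}$ for $x\in[(i-1)/N,i/N)$, $y\in[(j-1)/N,j/N)$. Cut norm $\|w\|_\square=\sup_{S,T\in\mathcal{B}(I)}|\int_{S\times T}w\,dxdy|$; $\mathcal{S}_I$ is the set of invertible bi-measurable Lebesgue-measure-preserving maps $\varphi:I\to I$; $w^\varphi(x,y)=w(\varphi(x),\varphi(y))$, $\boldsymbol{\alpha}^\varphi=(\alpha_{\varphi(x)})_{x\in I}$; $\delta_\square(w,w')=\inf_{\varphi\in\mathcal{S}_I}\|w^\varphi-w'\|_\square$; $d_{\mathcal{S}}(\boldsymbol{\alpha},\boldsymbol{\alpha}')=\inf_{\varphi\in\mathcal{S}_I}\|\boldsymbol{\alpha}^\varphi-\boldsymbol{\alpha}'\|_{L^2(I)}$. *)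

(* Defs.v *)
From HB Require Import structures.
From mathcomp Require Import all_boot all_order all_algebra.
From mathcomp Require Import all_classical all_reals all_analysis.
Set Implicit Arguments.
Unset Strict Implicit.
Unset Printing Implicit Defensive.
Import Order.TTheory GRing.Theory Num.Theory.
Import numFieldNormedType.Exports.
Local Open Scope classical_set_scope.
Local Open Scope ring_scope.

(* Functions on I = [0, 1] are represented by functions on R of which only the
   restriction to I matters; integrals, norms and "almost everywhere" refer to
   the restriction muI of Lebesgue measure to I. *)
Section unit_interval.
Variable R : realType.

Definition I01 : set R := `[0, 1].

Lemma measurable_I01 : measurable I01.
Proof. exact: measurable_itv. Qed.

Definition muI : set R -> \bar R := mrestr lebesgue_measure measurable_I01.

Let muI0 : muI set0 = 0%E.
Proof. exact: (measure0 (mrestr lebesgue_measure measurable_I01)). Qed.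

Let muI_ge0 S : (0 <= muI S)%E.
Proof. exact: (measure_ge0 (mrestr lebesgue_measure measurable_I01)). Qed.

Let muI_sigma_additive : semi_sigma_additive muI.
Proof.
exact: (@measure_semi_sigma_additive _ _ _
  (mrestr lebesgue_measure measurable_I01)).
Qed.

HB.instance Definition _ := isMeasure.Build _ _ _ muI
  muI0 muI_ge0 muI_sigma_additive.

Lemma muI_setT : muI setT = 1%E.
Proof.
by rewrite /muI /mrestr setTI /I01 lebesgue_measure_itv/= lte_fin ltr01 oppr0
  adde0.
Qed.

HB.instance Definition _ := Measure_isProbability.Build _ _ _ muI muI_setT.

End unit_interval.
Arguments I01 {R}.
Arguments muI {R}.

Section L2.
Context d (T : measurableType d) (R : realType).
Variable mu : {measure set T -> \bar R}.

Definition L2 : set (T -> R) := [set g | g \in Lfun mu 2%:E].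

Definition norm2 (g : T -> R) : R := fine ('N[mu]_(2%:E)[EFin \o g]).

End L2.

Section graphons.
Variable R : realType.
Implicit Types (w : R * R -> R) (g : R -> R).

Definition graphon w : Prop :=
  L2 (muI \x muI)%E w /\ forall x y, I01 x -> I01 y -> w (x, y) = w (y, x).

Definition graphon_norm2 w : R := norm2 (muI \x muI)%E w.

Definition graphon_op w g : R -> R :=
  fun x => \int[muI]_(y in I01) (w (x, y) * g y).

Definition graphon_opnorm w : R :=
  sup [set norm2 muI (graphon_op w g) | g in
        [set g | L2 muI g /\ norm2 muI g <= 1]].

Definition cut_norm w : R :=
  sup [set r | exists S T : set R,
    [/\ measurable S, measurable T, S `<=` I01, T `<=` I01 &
        r = `| \int[(muI \x muI)%E]_(p in S `*` T) w p | ] ].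

(* Invertible bi-measurable Lebesgue-measure-preserving maps of I; any such map
   extends measurably to R, e.g. by the identity outside I. *)
Definition mp_bij : set (R -> R) :=
  [set phi | exists psi : R -> R,
    [/\ measurable_fun setT phi, measurable_fun setT psi,
        (forall x, I01 x -> I01 (phi x)) /\ (forall x, I01 x -> I01 (psi x)),
        (forall x, I01 x -> psi (phi x) = x) /\
        (forall x, I01 x -> phi (psi x) = x) &
        forall S, measurable S -> muI (phi @^-1` S) = muI S]].

Definition delta_cut w w' : R :=
  inf [set cut_norm (fun p => w (phi p.1, phi p.2) - w' p) | phi in mp_bij].

Definition dist_S (a a' : R -> R) : R :=
  inf [set norm2 muI (fun x => a (phi x) - a' x) | phi in mp_bij].

Definition cell (N : nat) (i : 'I_N) : set R :=
  `[i%:R / N%:R, i.+1%:R / N%:R[.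

(* Players are numbered from 0. Both step functions vanish at the points with a
   coordinate equal to 1, which belongs to no cell. *)
Definition step1 (N : nat) (a : 'I_N -> R) : R -> R :=
  fun x => \sum_(i < N) a i * \1_(cell i) x.

Definition step2 (N : nat) (W : 'M[R]_N) : R * R -> R :=
  fun p => \sum_(i < N) \sum_(j < N) W i j * \1_(cell i) p.1 * \1_(cell j) p.2.

End graphons.

Section wasserstein.
Variable R : realType.
Implicit Types nu : probability (R * R)%type R.

Definition coupling nu nu' : set (probability ((R * R) * (R * R))%type R) :=
  [set pi | (forall B, measurable B -> pi (B `*` setT) = nu B) /\
            (forall B, measurable B -> pi (setT `*` B) = nu' B)].

Definition W2 nu nu' : \bar R :=
  sqrte (ereal_inf [set
    \int[pi]_q ((q.1.1 - q.2.1) ^+ 2 + (q.1.2 - q.2.2) ^+ 2)%:E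
    | pi in coupling nu nu'])%E.

End wasserstein.

(* [F] has derivative [l] at [a] relatively to [A]: two-sided in the interior of
   [A], one-sided at an end point of [A]. *)
Definition is_derive_within (R : realType) (A : set R) (F : R -> R) (a l : R) :=
  (F x - F a) / (x - a) @[x --> within A a^'] --> l.

Section costs.
Variables (R : realType) (mu0 : probability R R).
Variables (b : R -> R -> R) (f : R -> R -> R -> R).

Definition calK : set (probability (R * R)%type R) :=
  [set nu | forall B, measurable B -> nu (B `*` setT) = mu0 B].

(* W2 is a (finite) distance, and Jtilde can be expected to be defined, only on
   the members of calK with finite second moment: this predicate delimits where
   assumptions on Jtilde are made. *)
Definition finite_moment2 (nu : probability (R * R)%type R) : Prop :=
  (\int[nu]_p (p.1 ^+ 2 + p.2 ^+ 2)%:E < +oo)%E.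

Definition cost_integrand (a : R) (p : R * R) : R :=
  f (b a p.2 + p.1) a p.2.

(* [nu] is a bare set function so that Jtilde applies to the joint law of
   (xi_i, z_i) without packaging z_i as a bundled measurable function. *)
Definition Jtilde (a : R) (nu : set (R * R)%type -> \bar R) : R :=
  fine (\int[nu]_p (cost_integrand a p)%:E)%E.

Definition J (a z : R) : R := Jtilde a (mu0 \x \d_z)%E.

End costs.

Section finite_game.
Context (R : realType) (mu0 : probability R R).
Variables (A : set R) (b : R -> R -> R) (f : R -> R -> R -> R).
Variables (N : nat) (W : 'M[R]_N).
Context d (Omega : measurableType d) (P : probability Omega R).
Variable xi : 'I_N -> {RV P >-> R}.

Definition iid_law : Prop :=
  (forall i B, measurable B -> distribution P (xi i) B = mu0 B) /\
  (forall B : 'I_N -> set R, (forall i, measurable (B i)) ->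
     (P [set om | forall i, B i (xi i om)] =
      \prod_(i < N) P (xi i @^-1` B i))%E).

(* z in L2(Omega; R^N), the system holding almost surely. *)
Definition is_aggregate (a : 'I_N -> R) (z : 'I_N -> Omega -> R) : Prop :=
  (forall i, L2 P (z i)) /\
  {ae P, forall om, forall i,
    z i om = N%:R^-1 * \sum_(j < N) W i j * (b (a j) (z j om) + xi j om)}.

Definition well_posed : Prop :=
  forall a : 'I_N -> R, (forall i, A (a i)) ->
    exists z, is_aggregate a z /\
      forall z', is_aggregate a z' ->
        {ae P, forall om, forall i, z' i om = z i om}.

(* The value is only meaningful up to a.s. equality, and when an aggregate
   exists. *)
Definition aggregate (a : 'I_N -> R) : 'I_N -> Omega -> R :=
  xget (fun _ _ => 0) [set z | is_aggregate a z].

Definition player_cost (i : 'I_N) (a : 'I_N -> R) : R :=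
  Jtilde b f (a i) (pushforward P (fun om => (xi i om, aggregate a i om))).

Definition deviate (i : 'I_N) (beta : R) (a : 'I_N -> R) : 'I_N -> R :=
  fun j => if j == i then beta else a j.

Definition is_nash (a : 'I_N -> R) : Prop :=
  (forall i, A (a i)) /\
  forall i beta, A beta ->
    player_cost i a <= player_cost i (deviate i beta a).

End finite_game.

Section graphon_game.
Variables (R : realType) (mu0 : probability R R).
Variables (A : set R) (b : R -> R -> R) (f : R -> R -> R -> R).
Variable w : R * R -> R.

Definition admissible : set (R -> R) :=
  [set a | L2 muI a /\ forall x, I01 x -> A (a x)].

Definition is_graphon_aggregate (a z : R -> R) : Prop :=
  L2 muI z /\
  {ae muI, forall x, z x = graphon_op w (fun y => b (a y) (z y)) x}.

(* The value is only meaningful up to a.e. equality, and when an aggregate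
   exists. *)
Definition graphon_aggregate (a : R -> R) : R -> R :=
  xget (fun=> 0) [set z | is_graphon_aggregate a z].

Definition is_graphon_nash (a : R -> R) : Prop :=
  admissible a /\
  {ae muI, forall x, forall beta, A beta ->
    J mu0 b f (a x) (graphon_aggregate a x) <=
    J mu0 b f beta (graphon_aggregate a x)}.

End graphon_game.

(* Main.v *)
Require Import Defs.
From HB Require Import structures.
From mathcomp Require Import all_boot all_order all_algebra.
From mathcomp Require Import all_classical all_reals all_analysis.
From mathcomp Require Import measurable_realfun ring lra.
Set Implicit Arguments.
Unset Strict Implicit.
Unset Printing Implicit Defensive.
Import Order.TTheory GRing.Theory Num.Theory.
Import numFieldNormedType.Exports.
Local Open Scope classical_set_scope.
Local Open Scope ring_scope.

(** Why the equilibria converge.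

    The finite game with [N] players is compared with the graphon game through
    step functions on the unit interval, after a relabelling of the interval
    that nearly attains the cut distance between the step kernel and [w].

    Cut-norm convergence says that the relabelled kernels converge when tested
    against rectangles; since their [L2] norms are bounded, the pi-lambda theorem
    and the density of simple functions extend this to weak convergence
    ([weak_null_pi_system]).  As the norms converge as well, the convergence is
    strong in [L2] of the square ([cut_norm_strong]), and therefore uniform for
    the operators on bounded functions.

    In the finite game the aggregate is random only through a weighted mean of
    independent noise terms, of variance [O(1/N)] on average.  Fixing a sample
    point where the noise is no larger than on average replaces it by a
    deterministic vector [zb] that solves the noiseless system up to a small
    residue [r0].  A deviation of a single player changes the system by a bounded
    amount in one column only, so that the aggregate felt by that player, with or
    without deviation, stays close to its entry of [zb] ([deviation_estimate]).
    As the cost is Lipschitz in the Wasserstein distance, each action of the Nash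
    equilibrium almost minimizes [J] at the corresponding entry of [zb], with an
    error that vanishes on average over the players ([finite_nash_approx]).

    Strong convexity turns this into an estimate of the distance between the two
    equilibrium profiles by the distance between the two aggregates
    ([strongly_convex_minimizers], [action_stability]), whereas the aggregates
    differ by at most the distance between the kernels plus a multiple of the
    distance between the profiles ([aggregate_stability]).  The contraction
    condition on [w] says exactly that this loop has gain less than 1, hence
    [equilibrium_distance]: the distance between the profiles is controlled by
    quantities that tend to 0.  The graphon aggregate itself is a genuine fixed
    point by Picard iteration ([kernel_fixed_point]). *)

(** * Square-integrable functions *)

Lemma ler_sqr_abs (R : realDomainType) (x y : R) :
  `|x| <= `|y| -> x ^+ 2 <= y ^+ 2.
Proof.
move=> xy; rewrite -[leRHS]real_normK ?num_real//.
by rewrite -[leLHS]real_normK ?num_real// ler_pXn2r ?nnegrE.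
Qed.

Section square_integrable.
Context d (T : measurableType d) (R : realType).
Variable mu : {measure set T -> \bar R}.
Implicit Types f g : T -> R.

Lemma L2P f : L2 mu f <->
  measurable_fun setT f /\ (\int[mu]_x (f x ^+ 2)%:E < +oo)%E.
Proof.
rewrite /L2/= ; split.
  move=> fL; have /integrableP[_] := Lfun2_integrable_sqr fL.
  move: fL; rewrite inE => /andP[/[!inE]/= mf _] foo; split => //.
  move: foo; congr (_ < _)%E; apply: eq_integral => x _ /=.
  by rewrite ger0_norm// sqr_ge0.
move=> [mf foo]; rewrite inE; apply/andP; split; rewrite inE//= /finite_norm.
rewrite unlock poweR_lty//; move: foo; congr (_ < _)%E.
by apply: eq_integral => x _ /=; rewrite powR_mulrn// real_normK// num_real.
Qed.

Lemma L2_measurable f : L2 mu f -> measurable_fun setT f.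
Proof. by case/L2P. Qed.

Lemma norm2_ge0 f : 0 <= norm2 mu f.
Proof. by rewrite fine_ge0// Lnorm_ge0. Qed.

Lemma norm2_sqr f : L2 mu f ->
  ((norm2 mu f ^+ 2)%:E = \int[mu]_x (f x ^+ 2)%:E)%E.
Proof.
move=> fL; have /= := poweR_Lnorm mu (EFin \o f) (_ : 2%:R != 0 :> R).
have fin : 'N[mu]_(2%:E)[EFin \o f]%E \is a fin_num.
  rewrite ge0_fin_numE ?Lnorm_ge0//.
  by move: fL; rewrite /L2/= inE => /andP[_]; rewrite inE.
rewrite -[X in (X `^ _)%E = _](fineK fin) pnatr_eq0 => /(_ isT).
rewrite poweR_EFin powR_mulrn ?norm2_ge0// => ->.
by apply: eq_integral => x _ /=; rewrite powR_mulrn// real_normK// num_real.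
Qed.

Lemma L2_integrable_sqr f : L2 mu f ->
  mu.-integrable setT (EFin \o (fun x => f x ^+ 2)).
Proof. exact: Lfun2_integrable_sqr. Qed.

Lemma norm2_sqrR f : L2 mu f -> norm2 mu f ^+ 2 = \int[mu]_x (f x ^+ 2).
Proof. by move=> fL; rewrite /Rintegral -norm2_sqr. Qed.

Lemma L2_integrable_mul f g : L2 mu f -> L2 mu g ->
  mu.-integrable setT (EFin \o (fun x => f x * g x)).
Proof. by move=> fL gL; apply/Lfun1_integrable/Lfun2_mul_Lfun1. Qed.

Lemma L2N f : L2 mu f -> L2 mu (fun x => - f x).
Proof.
move=> /L2P[mf foo]; apply/L2P; split; first exact: measurableT_comp.
by under eq_integral do rewrite sqrrN.
Qed.

Lemma L2D f g : L2 mu f -> L2 mu g -> L2 mu (fun x => f x + g x).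
Proof.
move=> fL gL; have p1 : (1 <= 2%:E :> \bar R)%E by rewrite lee1n.
have [_ H] := @Lfun_addr_closed _ T R mu 2%:E p1.
exact: (H _ _ fL gL).
Qed.

Lemma L2B f g : L2 mu f -> L2 mu g -> L2 mu (fun x => f x - g x).
Proof. by move=> fL gL; apply: L2D => //; exact: L2N. Qed.

Lemma L2Z a f : L2 mu f -> L2 mu (fun x => a * f x).
Proof.
move=> fL; have := Lfun_scale a (ler1n R 2) fL; congr L2.
by apply/funext => x /=; rewrite mulrC.
Qed.

Lemma norm2_triangle f g : L2 mu f -> L2 mu g ->
  norm2 mu (fun x => f x + g x) <= norm2 mu f + norm2 mu g.
Proof.
have fin h : L2 mu h -> ('N[mu]_(2%:E)[EFin \o h] \is a fin_num)%E.
  move=> hL; rewrite ge0_fin_numE ?Lnorm_ge0//.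
  by move: hL; rewrite /L2/= inE => /andP[_]; rewrite inE.
move=> fL gL; rewrite -lee_fin EFinD !fineK ?fin//; last exact: L2D.
by apply: minkowski_EFin; [exact: L2_measurable..|rewrite ler1n].
Qed.

Lemma norm2N f : norm2 mu (fun x => - f x) = norm2 mu f.
Proof. by rewrite /norm2 -(oppe_Lnorm mu (EFin \o f)). Qed.

Lemma norm2_le_sqr f (c : R) : L2 mu f -> 0 <= c ->
  (\int[mu]_x (f x ^+ 2)%:E <= (c ^+ 2)%:E)%E -> norm2 mu f <= c.
Proof.
by move=> fL c0; rewrite -norm2_sqr// lee_fin ler_pXn2r// nnegrE norm2_ge0.
Qed.

Lemma ae_le_integral_sqr f (g : T -> R) : measurable_fun setT f ->
  measurable_fun setT g -> {ae mu, forall x, f x ^+ 2 <= g x} ->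
  (forall x, 0 <= g x) ->
  (\int[mu]_x (f x ^+ 2)%:E <= \int[mu]_x (g x)%:E)%E.
Proof.
move=> mf mg fg g0; apply: ae_ge0_le_integral => //.
- by move=> x _; rewrite lee_fin sqr_ge0.
- by apply/measurable_EFinP; exact: measurable_funX.
- by move=> x _; rewrite lee_fin.
- exact/measurable_EFinP.
- by apply: filterS fg => x; rewrite lee_fin.
Qed.

Lemma L2_ae_le f g : measurable_fun setT f -> L2 mu g ->
  {ae mu, forall x, `|f x| <= `|g x|} -> L2 mu f.
Proof.
move=> mf /[dup] gL /L2P[mg goo] fg; apply/L2P; split => //.
apply: le_lt_trans goo; apply: (@ae_le_integral_sqr f (fun x => g x ^+ 2)) => //.
- exact: measurable_funX.
- by apply: filterS fg => x; exact: ler_sqr_abs.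
- by move=> x; exact: sqr_ge0.
Qed.

Lemma norm2_ae_le f g : measurable_fun setT f -> L2 mu g ->
  {ae mu, forall x, `|f x| <= `|g x|} -> norm2 mu f <= norm2 mu g.
Proof.
move=> mf gL fg; have fL := L2_ae_le mf gL fg.
apply: norm2_le_sqr => //; first exact: norm2_ge0.
rewrite norm2_sqr//.
apply: (@ae_le_integral_sqr f (fun x => g x ^+ 2)) => //.
- by apply: measurable_funX; exact: L2_measurable.
- by apply: filterS fg => x; exact: ler_sqr_abs.
- by move=> x; exact: sqr_ge0.
Qed.

Lemma L2_ae_eq f g : measurable_fun setT f -> L2 mu g ->
  {ae mu, forall x, f x = g x} -> L2 mu f.
Proof. by move=> mf gL fg; apply: L2_ae_le gL _ => //; apply: filterS fg => x ->. Qed.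

Lemma norm2_ae_eq f g : measurable_fun setT f -> L2 mu g ->
  {ae mu, forall x, f x = g x} -> norm2 mu f = norm2 mu g.
Proof.
move=> mf gL fg; apply/eqP; rewrite eq_le norm2_ae_le//=; last first.
  by apply: filterS fg => x ->.
apply: norm2_ae_le; [exact: L2_measurable|exact: L2_ae_eq gL fg|].
by apply: filterS fg => x ->.
Qed.

Lemma cauchy_schwarz_abs f g : L2 mu f -> L2 mu g ->
  (\int[mu]_x `|f x * g x|%:E <= (norm2 mu f * norm2 mu g)%:E)%E.
Proof.
have fin h : L2 mu h -> ('N[mu]_(2%:E)[EFin \o h] \is a fin_num)%E.
  move=> hL; rewrite ge0_fin_numE ?Lnorm_ge0//.
  by move: hL; rewrite /L2/= inE => /andP[_]; rewrite inE.
move=> fL gL; rewrite EFinM !fineK ?fin//.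
have two0 : (0 < 2 :> R)%R by [].
have half : (2^-1 + 2^-1 = 1 :> R)%R by rewrite [RHS]splitr !div1r.
have := hoelder mu (L2_measurable fL) (L2_measurable gL) two0 two0 half.
by rewrite (Lnorm1 mu (EFin \o (f \* g))).
Qed.

Lemma cauchy_schwarz f g : L2 mu f -> L2 mu g ->
  `|\int[mu]_x (f x * g x)| <= norm2 mu f * norm2 mu g.
Proof.
move=> fL gL; have ifg := L2_integrable_mul fL gL.
rewrite -lee_fin EFin_normr_Rintegral//.
apply: le_trans (cauchy_schwarz_abs fL gL).
by apply: (le_trans (le_abse_integral _ _ _)) => //; exact: (measurable_int mu).
Qed.

End square_integrable.

Section square_integrable_finite.
Context d (T : measurableType d) (R : realType).
Variable mu : probability T R.
Implicit Types f g : T -> R.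

Lemma L2_bounded f c : measurable_fun setT f ->
  {ae mu, forall x, `|f x| <= c} -> L2 mu f.
Proof.
move=> mf fc; apply: (@L2_ae_le _ _ _ _ f (cst c)) => //.
  exact: Lfun_cst.
by apply: filterS fc => x /= h; rewrite (le_trans h)// ler_norm.
Qed.

Lemma norm2_cst c : norm2 mu (cst c) = `|c|.
Proof.
apply/eqP; rewrite -(@eqrXn2 _ 2)// ?norm2_ge0// -eqe.
rewrite norm2_sqr; last exact: Lfun_cst.
have -> : (\int[mu]_x (cst c x ^+ 2)%:E = (c ^+ 2)%:E)%E.
  rewrite -[RHS]mule1 -(probability_setT mu).
  exact: (integral_cst mu measurableT (c ^+ 2)%:E).
by rewrite real_normK// num_real.
Qed.

Lemma norm2_bounded f c : measurable_fun setT f ->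
  {ae mu, forall x, `|f x| <= c} -> norm2 mu f <= `|c|.
Proof.
move=> mf fc; rewrite -norm2_cst; apply: norm2_ae_le => //.
  exact: Lfun_cst.
by apply: filterS fc => x /= h; rewrite (le_trans h)// ler_norm.
Qed.

Lemma L2_integrable f : L2 mu f -> mu.-integrable setT (EFin \o f).
Proof.
move=> fL; have -> : f = (fun x => f x * cst 1 x) by apply/funext => x; rewrite mulr1.
by apply: L2_integrable_mul => //; exact: Lfun_cst.
Qed.

End square_integrable_finite.

(** * Integral operators with square-integrable kernels *)

Lemma measurable_sqrtr (R : realType) :
  measurable_fun [set: measurableTypeR R] (@Num.sqrt R).
Proof. by apply: continuous_measurable_fun; exact: sqrt_continuous. Qed.

Section kernels.
Context d1 d2 (T1 : measurableType d1) (T2 : measurableType d2) (R : realType).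
Variables (mu1 : probability T1 R) (mu2 : probability T2 R).
Implicit Types (w : T1 * T2 -> R) (g : T2 -> R).

Definition kernel_op w g : T1 -> R := fun x => \int[mu2]_y (w (x, y) * g y).

Definition row_norm w : T1 -> R := fun x => norm2 mu2 (fun y => w (x, y)).

Lemma measurable_sqr_row w : measurable_fun setT w ->
  measurable_fun setT (fun x => \int[mu2]_y (w (x, y) ^+ 2)%:E)%E.
Proof.
move=> mw; apply: (@measurable_fun_fubini_tonelli_F _ _ _ _ _ mu2
   (fun p => (w p ^+ 2)%:E)).
  by apply/measurable_EFinP; exact: measurable_funX.
by move=> x; rewrite lee_fin sqr_ge0.
Qed.

Lemma integral_sqr_rows w : measurable_fun setT w ->
  (\int[(mu1 \x mu2)%E]_p (w p ^+ 2)%:E =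
   \int[mu1]_x \int[mu2]_y (w (x, y) ^+ 2)%:E)%E.
Proof.
move=> mw; rewrite fubini_tonelli1//.
  by apply/measurable_EFinP; exact: measurable_funX.
by move=> x; rewrite lee_fin sqr_ge0.
Qed.

Lemma ae_L2_row w : L2 (mu1 \x mu2)%E w ->
  {ae mu1, forall x, L2 mu2 (fun y => w (x, y))}.
Proof.
move=> /L2P[mw woo].
have /integrable_ae : mu1.-integrable setT
    (fun x => \int[mu2]_y (w (x, y) ^+ 2)%:E)%E.
  apply/integrableP; split; first exact: measurable_sqr_row.
  rewrite integral_sqr_rows// in woo; apply: le_lt_trans woo.
  rewrite le_eqVlt; apply/orP; left; apply/eqP; apply: eq_integral => x _.
  by rewrite gee0_abs// integral_ge0// => y _; rewrite lee_fin sqr_ge0.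
move=> /(_ measurableT); apply: filterS => x /(_ I) fin.
apply/L2P; split; first exact: measurable_fun_pair2.
by rewrite ltey_eq fin.
Qed.

(** [row_norm] is an [L2] norm of rows, some of which may fail to be square
    integrable: there both sides of the formula used below take the value 0. *)
Lemma measurable_row_norm w : L2 (mu1 \x mu2)%E w ->
  measurable_fun setT (row_norm w).
Proof.
move=> /L2P[mw woo].
have -> : row_norm w =
    (fun x => Num.sqrt (fine (\int[mu2]_y (w (x, y) ^+ 2)%:E)%E)).
  apply/funext => x; rewrite /row_norm.
  have [wL|wL] := pselect (L2 mu2 (fun y => w (x, y))).
    by rewrite -(norm2_sqr wL)/= sqrtr_sqr ger0_norm// norm2_ge0.
  have mwx : measurable_fun setT (fun y => w (x, y)) by exact: measurable_fun_pair2.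
  have woox : (\int[mu2]_y (w (x, y) ^+ 2)%:E = +oo)%E.
    apply/eqP; rewrite eq_le leey/= leNgt; apply/negP => h.
    by apply: wL; apply/L2P.
  rewrite woox/= sqrtr0 /norm2.
  suff -> : ('N[mu2]_(2%:E)[EFin \o (fun y => w (x, y))] = +oo)%E by [].
  apply/eqP; rewrite eq_le leey/= leNgt; apply/negP => h; apply: wL.
  by rewrite /L2/= inE; apply/andP; split; rewrite inE.
apply: (measurableT_comp (@measurable_sqrtr R)).
apply: (measurableT_comp (@fine_measurable R setT measurableT)) => //.
exact: measurable_sqr_row.
Qed.

(** Tonelli's theorem: the norms of the rows have the norm of the kernel. *)
Lemma L2_row_norm w : L2 (mu1 \x mu2)%E w ->
  L2 mu1 (row_norm w) /\ norm2 mu1 (row_norm w) = norm2 (mu1 \x mu2)%E w.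
Proof.
move=> wL; have mrow := measurable_row_norm wL.
have E : (\int[mu1]_x (row_norm w x ^+ 2)%:E =
    \int[(mu1 \x mu2)%E]_p (w p ^+ 2)%:E)%E.
  rewrite integral_sqr_rows; last exact: (L2_measurable wL).
  apply: ae_eq_integral => //.
  - by apply/measurable_EFinP; exact: measurable_funX.
  - by apply: measurable_sqr_row; exact: (L2_measurable wL).
  - by apply: filterS (ae_L2_row wL) => x wxL _; rewrite norm2_sqr.
have rL : L2 mu1 (row_norm w) by apply/L2P; split => //; rewrite E; case/L2P: wL.
split => //; apply/eqP; rewrite -(@eqrXn2 _ 2)// ?norm2_ge0// -eqe.
by rewrite !norm2_sqr// E.
Qed.

Lemma L2_snd g : L2 mu2 g -> L2 (mu1 \x mu2)%E (fun p => g p.2).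
Proof.
move=> /L2P[mg goo]; apply/L2P.
have mg2 : measurable_fun setT (fun p : T1 * T2 => g p.2) by exact: measurableT_comp.
split => //; rewrite integral_sqr_rows//=.
rewrite (integral_cst mu1 measurableT (\int[mu2]_y (g y ^+ 2)%:E)%E).
rewrite [X in (_ * X)%E](_ : _ = 1%E) ?mule1//; exact: probability_setT.
Qed.

Lemma kernel_integrable w g : L2 (mu1 \x mu2)%E w -> L2 mu2 g ->
  (mu1 \x mu2)%E.-integrable setT (EFin \o (fun p => w p * g p.2)).
Proof. by move=> wL gL; apply: L2_integrable_mul => //; exact: L2_snd. Qed.

Lemma measurable_kernel_op w g : L2 (mu1 \x mu2)%E w -> L2 mu2 g ->
  measurable_fun setT (kernel_op w g).
Proof.
move=> wL gL; apply: (measurableT_comp (@fine_measurable R setT measurableT)) => //.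
exact: (measurable_fubini_F (kernel_integrable wL gL)).
Qed.

Lemma kernel_op_row_le w g x : L2 mu2 (fun y => w (x, y)) -> L2 mu2 g ->
  `|kernel_op w g x| <= row_norm w x * norm2 mu2 g.
Proof. by move=> wL gL; exact: cauchy_schwarz. Qed.

Lemma L2_kernel_op w g : L2 (mu1 \x mu2)%E w -> L2 mu2 g ->
  L2 mu1 (kernel_op w g).
Proof.
move=> wL gL; have [rL _] := L2_row_norm wL.
apply: (@L2_ae_le _ _ _ _ _ (fun x => norm2 mu2 g * row_norm w x)).
- exact: measurable_kernel_op.
- exact: L2Z.
- apply: filterS (ae_L2_row wL) => x wxL.
  rewrite (le_trans (kernel_op_row_le wxL gL))//.
  by rewrite mulrC ler_norm.
Qed.

(** The Hilbert-Schmidt bound, by the Cauchy-Schwarz inequality in each row. *)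
Lemma norm2_kernel_op w g : L2 (mu1 \x mu2)%E w -> L2 mu2 g ->
  norm2 mu1 (kernel_op w g) <= norm2 (mu1 \x mu2)%E w * norm2 mu2 g.
Proof.
move=> wL gL; have [rL <-] := L2_row_norm wL.
apply: norm2_le_sqr; first exact: L2_kernel_op.
  by rewrite mulr_ge0 ?norm2_ge0.
apply: (@le_trans _ _ (\int[mu1]_x ((norm2 mu2 g * row_norm w x) ^+ 2)%:E)%E).
  apply: (@ae_le_integral_sqr _ _ _ _ _ (fun x => (norm2 mu2 g * row_norm w x) ^+ 2)).
  - exact: measurable_kernel_op.
  - by apply: measurable_funX; apply: measurable_funM => //; exact: measurable_row_norm.
  - apply: filterS (ae_L2_row wL) => x wxL; apply: ler_sqr_abs.
    rewrite (le_trans (kernel_op_row_le wxL gL))//.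
    by rewrite mulrC ler_norm.
  - by move=> x; exact: sqr_ge0.
under eq_integral do rewrite exprMn EFinM.
rewrite integralZl//; last exact: L2_integrable_sqr.
by rewrite -(norm2_sqr rL) -EFinM -exprMn mulrC.
Qed.

End kernels.

(** * The unit interval and the operator norm of a graphon *)

Section unit_interval_measure.
Variable R : realType.
Implicit Types (P : R -> Prop) (f g : R -> R) (w : R * R -> R).

Lemma muIE (S : set R) : muI S = lebesgue_measure (S `&` I01).
Proof. by []. Qed.

Lemma muI_ae P : (forall x, I01 x -> P x) -> {ae muI, forall x, P x}.
Proof.
move=> H; exists (~` I01); split.
- by apply: measurableC; exact: measurable_I01.
- by rewrite /= muIE setICl measure0.
- by move=> x /= nP Ix; apply: nP; exact: H.
Qed.

Lemma muI_ae_lt1 P : (forall x, 0 <= x -> x < 1 -> P x) ->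
  {ae muI, forall x, P x}.
Proof.
move=> H; exists (~` (`[0, 1[%classic : set R)); split.
- exact: measurableC.
- rewrite /= muIE; apply/eqP; rewrite eq_le measure_ge0 andbT.
  rewrite -(@lebesgue_measure_set1 R 1); apply: le_measure.
  + rewrite inE; apply: measurableI; last exact: measurable_I01.
    exact: measurableC.
  + by rewrite inE.
  + move=> x [/=]; rewrite /I01/= !in_itv/= => h /andP[x0 x1].
    apply/eqP; rewrite eq_le x1/= leNgt; apply/negP => x1'.
    by apply: h; rewrite x0.
- move=> x /= nP; rewrite in_itv/= => /andP[x0 x1]; apply: nP; exact: H.
Qed.

Lemma integral_muI_I01 (f : R -> \bar R) : measurable_fun setT f ->
  (\int[muI]_(x in I01) f x = \int[muI]_x f x)%E.
Proof.
move=> mf; rewrite integral_mkcond; apply: ae_eq_integral => //.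
- apply: (measurable_restrictT f (@measurable_I01 R)).1.
  exact: measurable_funTS.
- by apply: muI_ae => x Ix _; rewrite patchE mem_set.
Qed.

Lemma graphon_opE w g : measurable_fun setT w -> measurable_fun setT g ->
  graphon_op w g = kernel_op muI w g.
Proof.
move=> mw mg; apply/funext => x; rewrite /graphon_op /kernel_op /Rintegral.
rewrite integral_muI_I01//; apply/measurable_EFinP; apply: measurable_funM => //.
exact: measurable_fun_pair2.
Qed.

Lemma eq_graphon_op w f g : (forall x, I01 x -> f x = g x) ->
  graphon_op w f = graphon_op w g.
Proof.
move=> fg; apply/funext => x; apply: eq_Rintegral => y.
by rewrite inE => /fg ->.
Qed.

Lemma graphon_opnorm_has_sup w : L2 (muI \x muI)%E w ->
  has_sup [set norm2 muI (graphon_op w g) | g in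
        [set g | L2 muI g /\ norm2 muI g <= 1]].
Proof.
move=> wL; split.
  exists (norm2 muI (graphon_op w (cst 0))); exists (cst 0) => //=; split.
    exact: Lfun_cst.
  by rewrite norm2_cst normr0.
exists (norm2 (muI \x muI)%E w) => _ [g [gL g1] <-].
rewrite graphon_opE; [|exact: (L2_measurable wL)|exact: (L2_measurable gL)].
rewrite (le_trans (norm2_kernel_op wL gL))// ler_piMr// norm2_ge0//.
Qed.

Lemma graphon_opnorm_ge0 w : L2 (muI \x muI)%E w -> 0 <= graphon_opnorm w.
Proof.
move=> wL; have [[r [g gL gr]] ub] := graphon_opnorm_has_sup wL.
apply: (@le_trans _ _ r); first by rewrite -gr norm2_ge0.
by apply: ub_le_sup => //; exists g.
Qed.

(** By homogeneity, from the unit ball over which the supremum is taken; a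
    function of norm 0 is covered by the Hilbert-Schmidt bound. *)
Lemma norm2_graphon_op w g : L2 (muI \x muI)%E w -> L2 muI g ->
  norm2 muI (kernel_op muI w g) <= graphon_opnorm w * norm2 muI g.
Proof.
move=> wL gL; have [|g0] := leP (norm2 muI g) 0.
  move=> g0; have {}g0 : norm2 muI g = 0.
    by apply/eqP; rewrite eq_le g0 norm2_ge0.
  by rewrite (le_trans (norm2_kernel_op wL gL))// g0 !mulr0.
set n := norm2 muI g in g0 *.
have hL : L2 muI (fun x => n^-1 * g x) by exact: L2Z.
have nZ v c : L2 muI v -> 0 <= c ->
    norm2 muI (fun x => c * v x) = c * norm2 muI v.
  move=> vL c0; apply/eqP; rewrite -(@eqrXn2 _ 2)// ?norm2_ge0//; last first.
    by rewrite mulr_ge0 ?norm2_ge0.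
  rewrite exprMn !norm2_sqrR//; last exact: L2Z.
  rewrite -RintegralZl//; last exact: L2_integrable_sqr.
  by apply/eqP; apply: eq_Rintegral => x _; rewrite exprMn.
have h1 : norm2 muI (fun x => n^-1 * g x) <= 1.
  by rewrite nZ ?invr_ge0 ?(ltW g0)// mulVf// gt_eqF.
have : norm2 muI (kernel_op muI w (fun x => n^-1 * g x)) <= graphon_opnorm w.
  have [_ ub] := graphon_opnorm_has_sup wL.
  rewrite -graphon_opE; [|exact: (L2_measurable wL)|exact: (L2_measurable hL)].
  by apply: ub_le_sup => //; exists (fun x => n^-1 * g x).
have -> : norm2 muI (kernel_op muI w (fun x => n^-1 * g x)) =
    norm2 muI (fun x => n^-1 * kernel_op muI w g x).
  apply: norm2_ae_eq.
  - exact: (measurable_kernel_op wL hL).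
  - by apply: L2Z; exact: L2_kernel_op.
  - apply: filterS (ae_L2_row wL) => x wxL.
    rewrite /kernel_op -RintegralZl//; last exact: L2_integrable_mul.
    by apply: eq_Rintegral => y _; rewrite mulrCA.
rewrite nZ; [|exact: L2_kernel_op|by rewrite invr_ge0 ltW].
by rewrite mulrC ler_pdivrMr.
Qed.

End unit_interval_measure.

(** * Retraction on the action set and measurability of compositions *)

Section projection.
Variables (R : realType) (A : set R).
Hypotheses (A0 : A !=set0) (Acl : closed A) (Acv : convex_set (A : set R^o)).

Lemma convex_set_combination x y t : A x -> A y -> 0 <= t -> t <= 1 ->
  A (t * x + (1 - t) * y).
Proof.
move=> Ax Ay t0 t1; have := Acv (Itv01 t0 t1) (mem_set Ax) (mem_set Ay).
by rewrite inE.
Qed.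

Lemma convex_set_between x y z : A x -> A y -> x <= z -> z <= y -> A z.
Proof.
move=> Ax Ay xz zy; have [xy|yx] := ltP x y; last first.
  by have -> : z = x by apply/eqP; rewrite eq_le xz (le_trans zy).
have yx0 : 0 < y - x by rewrite subr_gt0.
have -> : z = ((z - x) / (y - x)) * y + (1 - (z - x) / (y - x)) * x.
  by field; rewrite gt_eqF.
apply: convex_set_combination => //; first by rewrite divr_ge0 ?subr_ge0 // ltW.
by rewrite ler_pdivrMr// mul1r lerD2r.
Qed.

Lemma closed_adherent x : (forall e, 0 < e -> exists2 a, A a & `|x - a| < e) ->
  A x.
Proof.
move=> H; have -> : A = closure A by apply/closure_id.
move=> B /nbhs_ballP[e /= e0 Be]; have [a Aa xa] := H _ e0.
by exists a; split => //; apply: Be.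
Qed.

(** The variational form of the projection: used at two points, it makes the
    retraction below nonexpansive. *)
Lemma exists_projection x :
  exists2 p, A p & forall a, A a -> (x - p) * (a - p) <= 0.
Proof.
have [Ax|nAx] := pselect (A x).
  by exists x => // a _; rewrite subrr mul0r.
have [a0 Aa0] := A0.
have [xa|ax] := leP x a0.
- have lb : lbound A x.
    move=> a Aa; rewrite leNgt; apply/negP => ax; apply: nAx.
    by apply: (convex_set_between Aa Aa0) => //; exact: ltW.
  have hA : has_inf A by split => //; exists x.
  exists (inf A).
    apply: closed_adherent => e e0; have [a Aa ae] := inf_adherent e0 hA.
    exists a => //; rewrite distrC ger0_norm ?ltrBlDl// subr_ge0.
    by apply: ge_inf => //; exists x.
  move=> a Aa; apply: mulr_le0_ge0.
    by rewrite subr_le0; apply: lb_le_inf.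
  by rewrite subr_ge0; apply: ge_inf => //; exists x.
- have ub : ubound A x.
    move=> a Aa; rewrite leNgt; apply/negP => xa; apply: nAx.
    by apply: (convex_set_between Aa0 Aa) => //; exact: ltW.
  have hA : has_sup A by split => //; exists x.
  exists (sup A).
    apply: closed_adherent => e e0; have [a Aa ae] := sup_adherent e0 hA.
    exists a => //; rewrite ger0_norm ?ltrBlDl// ?subr_ge0.
      by rewrite -ltrBlDr.
    by apply: ub_le_sup => //; exists x.
  move=> a Aa; apply: mulr_ge0_le0.
    by rewrite subr_ge0; apply: ge_sup.
  by rewrite subr_le0; apply: ub_le_sup => //; exists x.
Qed.

Lemma exists_retraction : exists p : R -> R,
  [/\ forall x, A (p x), forall x, A x -> p x = x &
      forall x y, `|p x - p y| <= `|x - y|].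
Proof.
have /choice[p pP] : forall x, exists p, A p /\
    forall a, A a -> (x - p) * (a - p) <= 0.
  by move=> x; have [p Ap H] := exists_projection x; exists p.
exists p; split.
- by move=> x; case: (pP x).
- move=> x Ax; have [_ /(_ _ Ax)] := pP x.
  rewrite -expr2 => h; apply/eqP; rewrite eq_sym -subr_eq0 -sqrf_eq0.
  by rewrite eq_le h sqr_ge0.
- move=> x y; have [Apx Hx] := pP x; have [Apy Hy] := pP y.
  have h1 := Hx _ Apy; have h2 := Hy _ Apx.
  have [->|neq] := eqVneq (p x) (p y); first by rewrite subrr normr0.
  have h : `|p x - p y| ^+ 2 <= `|x - y| * `|p x - p y|.
    rewrite real_normK ?num_real// -normrM.
    apply: le_trans (ler_norm _); rewrite -subr_ge0.
    nra.
  by rewrite expr2 ler_pM2r ?normr_gt0 ?subr_eq0 in h.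
Qed.

End projection.

Lemma measurable_fun_lt_cut d (T : measurableType d) (R : realType) (h : T -> R) :
  (forall c, measurable [set t | h t < c]) -> measurable_fun setT h.
Proof.
move=> mh _; apply: (measurability _ (RGenInftyO.measurableE R)) => //.
move=> _ [_ [x ->] <-]; rewrite setTI.
by have := mh x; congr measurable; apply/seteqP; split => t /=; rewrite in_itv.
Qed.

(** The bound on the increments makes [h] Lipschitz in its second argument, so
    [h (f t) (g t)] lies below [c] as soon as [h (f t) q] does, with a margin
    proportional to the distance from [q] to [g t], for a rational [q]. *)
Lemma measurable_fun_lipschitz2 d (T : measurableType d) (R : realType)
    (h : R -> R -> R) (ca cz : R) (f g : T -> R) : 0 <= ca -> 0 <= cz ->
  (forall a a' z z', `|h a z - h a' z'| ^+ 2 <=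
     ca * `|a - a'| ^+ 2 + cz * `|z - z'| ^+ 2) ->
  measurable_fun setT f -> measurable_fun setT g ->
  measurable_fun setT (fun t => h (f t) (g t)).
Proof.
move=> ca0 cz0 hl mf mg.
have lipz a z z' : `|h a z - h a z'| <= Num.sqrt cz * `|z - z'|.
  rewrite -(@ler_pXn2r _ 2)// ?nnegrE ?mulr_ge0 ?sqrtr_ge0//.
  rewrite exprMn sqr_sqrtr//; apply: le_trans (hl _ _ _ _) _.
  by rewrite subrr normr0 expr0n/= mulr0 add0r.
have lipa a a' z : `|h a z - h a' z| <= Num.sqrt ca * `|a - a'|.
  rewrite -(@ler_pXn2r _ 2)// ?nnegrE ?mulr_ge0 ?sqrtr_ge0//.
  rewrite exprMn sqr_sqrtr//; apply: le_trans (hl _ _ _ _) _.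
  by rewrite subrr normr0 expr0n/= mulr0 addr0.
have mfix q : measurable_fun setT (fun t => h (f t) q).
  apply: (@measurableT_comp _ _ _ _ _ _ (fun a : measurableTypeR R => h a q)) => //.
  apply: continuous_measurable_fun => a.
  apply/cvgrPdist_lt => e e0.
  have s0 : 0 < Num.sqrt ca + 1 by rewrite ltr_wpDl// sqrtr_ge0.
  near=> a'; apply: le_lt_trans (lipa _ _ _) _.
  have aa' : `|a - a'| < e / (Num.sqrt ca + 1).
    near: a'; apply: (@cvgr_dist_lt _ _ _ (nbhs a) _ id a) => //.
    by rewrite divr_gt0.
  rewrite ltr_pdivlMr// in aa'; apply: le_lt_trans aa'.
  by rewrite mulrC ler_wpM2l// lerDl.
apply: measurable_fun_lt_cut => c.
rewrite (_ : [set t | _] = \bigcup_(q : rat)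
   [set t | h (f t) (ratr q) + Num.sqrt cz * `|g t - ratr q| < c]); last first.
  apply/seteqP; split => t /=.
  - move=> tc; pose e := c - h (f t) (g t).
    have e0 : 0 < e by rewrite subr_gt0.
    pose s := Num.sqrt cz + 1.
    have s0 : 0 < s by rewrite ltr_wpDl// sqrtr_ge0.
    have [q] : exists q : rat, ratr q \in `](g t - e / (2 * s)), g t[.
      by apply/rat_in_itvoo; rewrite ltrBlDr ltrDl divr_gt0// mulr_gt0.
    rewrite in_itv/= => /andP[q1 q2]; exists q => //=.
    have qd : `|g t - ratr q| < e / (2 * s).
      by rewrite ger0_norm ?subr_ge0 ?(ltW q2)// ltrBlDr addrC -ltrBlDr.
    have l1 := lipz (f t) (ratr q) (g t); rewrite distrC in l1.
    rewrite (distrC (ratr q)) in l1.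
    have l2 : h (f t) (ratr q) - h (f t) (g t) <= Num.sqrt cz * `|g t - ratr q|.
      by apply: le_trans l1; rewrite distrC ler_norm.
    have l3 : Num.sqrt cz * `|g t - ratr q| <= s * `|g t - ratr q|.
      by rewrite ler_wpM2r// lerDl.
    have l4 : s * `|g t - ratr q| < e / 2.
      move: qd; rewrite invfM mulrA ltr_pdivlMr//; rewrite mulrC; lra.
    rewrite /e in l4; lra.
  - move=> [q _ /=] tc.
    have := lipz (f t) (g t) (ratr q); have := ler_norm (h (f t) (g t) - h (f t) (ratr q)).
    lra.
apply: bigcupT_measurable_rat => q.
rewrite (_ : [set t | _] = (fun t => h (f t) (ratr q) +
    Num.sqrt cz * `|g t - ratr q|) @^-1` `]-oo, c[%classic); last first.
  by apply/seteqP; split => t /=; rewrite in_itv.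
have m : measurable_fun setT (fun t => h (f t) (ratr q) +
    Num.sqrt cz * `|g t - ratr q|).
  apply: measurable_funD => //; apply: measurable_funM => //.
  apply: measurableT_comp => //; exact: measurable_funB.
by rewrite -[_ @^-1` _]setTI; apply: m.
Unshelve. all: by end_near.
Qed.

(** * Weak and strong convergence *)

Lemma eq_cvgn (R : realType) (u v : nat -> R) (l : R) : (forall n, u n = v n) ->
  v n @[n --> \oo] --> l -> u n @[n --> \oo] --> l.
Proof. by move=> uv; rewrite (funext uv). Qed.

Lemma near_eq_cvgn (R : realType) (u v : nat -> R) (l : R) :
  (\forall n \near \oo, u n = v n) ->
  v n @[n --> \oo] --> l -> u n @[n --> \oo] --> l.
Proof.
by move=> uv vl; apply: cvg_trans vl; apply: near_eq_cvg; apply: filterS uv.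
Qed.

Lemma cvg0_sqr (R : realType) (u : nat -> R) :
  u k ^+ 2 @[k --> \oo] --> (0 : R) -> u k @[k --> \oo] --> (0 : R).
Proof.
move=> /cvgr0Pnorm_lt h; apply/cvgr0Pnorm_lt => e e0.
have := h _ (exprn_gt0 2 e0); apply: filterS => k.
by rewrite normrX ltr_pXn2r ?nnegrE// ltW.
Qed.

Section weak_convergence.
Context d (T : measurableType d) (R : realType).
Variable mu : probability T R.
Implicit Types h : T -> R.

Lemma norm2_dominated_cvg (h_ : nat -> T -> R) (h H : T -> R) :
  (forall k, measurable_fun setT (h_ k)) -> L2 mu H ->
  (forall k x, `|h_ k x| <= `|H x|) ->
  (forall x, h_ k x @[k --> \oo] --> h x) ->
  L2 mu h /\ norm2 mu (fun x => h x - h_ k x) @[k --> \oo] --> (0 : R).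
Proof.
move=> mh HL hH hc.
have mh0 : measurable_fun setT h.
  by apply: (measurable_fun_cvg mh) => x _; exact: hc.
have hleH x : `|h x| <= `|H x|.
  have hcx : `|h_ k x| @[k --> \oo] --> `|h x| by apply: cvg_norm; exact: hc.
  rewrite -(cvg_lim (@Rhausdorff R) hcx).
  apply: limr_le; first by apply/cvg_ex; exists `|h x|.
  by near=> k; exact: hH.
have hkL k : L2 mu (h_ k) by apply: L2_ae_le HL _ => //; apply: aeW.
have hL : L2 mu h by apply: L2_ae_le HL _ => //; apply: aeW.
split => //.
have dL k : L2 mu (fun x => h x - h_ k x) by exact: L2B.
have HL2 : L2 mu (fun x => 2 * H x) by exact: L2Z.
pose F k x := ((h x - h_ k x) ^+ 2)%:E.
pose G x := ((2 * H x) ^+ 2)%:E.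
have mF k : measurable_fun setT (F k).
  by apply/measurable_EFinP; apply: measurable_funX; exact: measurable_funB.
have cF : {ae mu, forall x, setT x -> F k x @[k --> \oo] --> (cst 0%E x : \bar R)}.
  apply: aeW => x _ /=; apply: cvg_EFin; first by near=> k.
  rewrite /F/=.
  have : h x - h_ k x @[k --> \oo] --> (0 : R).
    by rewrite -(subrr (h x)); apply: cvgB => //; exact: cvg_cst.
  move=> c0; rewrite -[X in _ --> X](mulr0 (0 : R)); exact: cvgM.
have FG : {ae mu, forall x, forall k, setT x -> (`|F k x| <= G x)%E}.
  apply: aeW => x k _; rewrite /F /G gee0_abs ?lee_fin ?sqr_ge0//.
  apply: ler_sqr_abs; rewrite (le_trans (ler_normB _ _))//.
  by rewrite normrM ger0_norm// mulr_natl mulr2n lerD.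
have [_ _ c] := dominated_convergence measurableT mF (measurable_cst _) cF
  (L2_integrable_sqr HL2) FG.
rewrite integral0 in c.
apply: cvg0_sqr.
apply: eq_cvgn (fine_cvg c) => k.
by rewrite /F /= (eq_integral (fun x => ((h x - h_ k x) ^+ 2)%:E)) -?norm2_sqr//
  => x _; rewrite sube0 gee0_abs ?lee_fin ?sqr_ge0.
Unshelve. all: by end_near.
Qed.

(** Weak convergence to 0 in [L2], kept relative to one test function so that
    the class of test functions can be enlarged step by step. *)
Definition weak_null (g : nat -> T -> R) h :=
  \int[mu]_x (g n x * h x) @[n --> \oo] --> (0 : R).

Variables (g : nat -> T -> R) (K : R).
Hypotheses (gL : forall n, L2 mu (g n)) (gK : forall n, norm2 mu (g n) <= K).

(** The pairings with a bounded sequence are equicontinuous in the test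
    function. *)
Lemma weak_null_closed h : L2 mu h ->
  (forall e, 0 < e -> exists h', [/\ L2 mu h', weak_null g h' &
     norm2 mu (fun x => h x - h' x) <= e]) -> weak_null g h.
Proof.
move=> hL H; apply/cvgr0Pnorm_lt => e e0.
have K0 : 0 <= K by apply: le_trans (gK 0); exact: norm2_ge0.
have K1 : 0 < K + 1 by rewrite ltr_wpDl.
have [h' [h'L + d']] := H (e / 2 / (K + 1)) (divr_gt0 (divr_gt0 e0 (ltr0n _ 2)) K1).
move=> /cvgr0Pnorm_lt /(_ _ (divr_gt0 e0 (ltr0n _ 2))).
apply: filterS => n hn.
have -> : \int[mu]_x (g n x * h x) =
    \int[mu]_x (g n x * h' x) + \int[mu]_x (g n x * (h x - h' x)).
  rewrite -RintegralD//; [|exact: L2_integrable_mul|]; last first.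
    by apply: L2_integrable_mul => //; exact: L2B.
  by apply: eq_Rintegral => x _; rewrite -mulrDr subrKC.
apply: le_lt_trans (ler_normD _ _) _.
rewrite [ltRHS]splitr; apply: ltr_leD => //.
apply: le_trans (cauchy_schwarz (gL n) (L2B hL h'L)) _.
apply: (@le_trans _ _ (K * (e / 2 / (K + 1)))).
  by apply: ler_pM => //; exact: norm2_ge0.
by rewrite mulrA ler_pdivrMr// mulrC ler_wpM2l ?lerDl// divr_ge0// ltW.
Qed.

Lemma weak_null_dominated (h_ : nat -> T -> R) (h H : T -> R) :
  (forall k, measurable_fun setT (h_ k)) -> L2 mu H ->
  (forall k x, `|h_ k x| <= `|H x|) ->
  (forall x, h_ k x @[k --> \oo] --> h x) ->
  (forall k, weak_null g (h_ k)) -> weak_null g h.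
Proof.
move=> mh HL hH hc wn.
have [hL c] := norm2_dominated_cvg mh HL hH hc.
apply: weak_null_closed => // e e0.
have /cvgr0Pnorm_lt/(_ _ e0)[k _ /(_ k (leqnn k))/= ck] := c.
exists (h_ k); split => //.
  by apply: L2_ae_le HL _ => //; apply: aeW.
by rewrite ltW// (le_lt_trans _ ck)// ler_norm.
Qed.

Lemma weak_nullZ a h : L2 mu h -> weak_null g h -> weak_null g (fun x => a * h x).
Proof.
move=> hL wn; rewrite /weak_null -(mulr0 a).
apply: (@eq_cvgn _ _ (fun n => a * \int[mu]_x (g n x * h x))).
  move=> n; rewrite -RintegralZl//; last exact: L2_integrable_mul.
  by apply: eq_Rintegral => x _; rewrite mulrCA.
by apply: cvgM => //; exact: cvg_cst.
Qed.

Lemma weak_nullD h h' : L2 mu h -> L2 mu h' -> weak_null g h ->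
  weak_null g h' -> weak_null g (fun x => h x + h' x).
Proof.
move=> hL hL' wn wn'; rewrite /weak_null -(addr0 (0 : R)).
apply: (@eq_cvgn _ _ (fun n => \int[mu]_x (g n x * h x) +
  \int[mu]_x (g n x * h' x))); last exact: cvgD.
move=> n; rewrite -RintegralD//; [|exact: L2_integrable_mul..].
by apply: eq_Rintegral => x _; rewrite mulrDr.
Qed.

Lemma weak_null0 : weak_null g (cst 0).
Proof.
rewrite /weak_null; apply: eq_cvgn (cvg_cst _) => n.
by under eq_Rintegral do rewrite mulr0; rewrite Rintegral_cst// mul0r.
Qed.

Lemma L2_indic (E : set T) : measurable E -> L2 mu (\1_E : T -> R).
Proof.
move=> mE; apply: (@L2_bounded _ _ _ _ _ 1); first exact: measurable_indic.
by apply: aeW => x; rewrite indicE; case: (_ \in _); rewrite /= ?normr1 ?normr0.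
Qed.

Lemma weak_null_sum I (r : seq I) (c : I -> R) (E : I -> set T) :
  (forall i, measurable (E i)) -> (forall i, weak_null g (\1_(E i))) ->
  weak_null g (fun x => \sum_(i <- r) c i * \1_(E i) x).
Proof.
move=> mE wn.
suff [_ //] : L2 mu (fun x => \sum_(i <- r) c i * \1_(E i) x) /\
  weak_null g (fun x => \sum_(i <- r) c i * \1_(E i) x).
elim: r => [|i r [IHL IH]].
  rewrite (_ : (fun _ => _) = cst 0); last by apply/funext => x; rewrite big_nil.
  by split; [exact: Lfun_cst|exact: weak_null0].
rewrite (_ : (fun _ => _) = (fun x => c i * \1_(E i) x +
  \sum_(j <- r) c j * \1_(E j) x)); last by apply/funext => x; rewrite big_cons.
have EL := L2_indic (mE i).
split; first by apply: L2D => //; exact: L2Z.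
by apply: weak_nullD => //; [exact: L2Z|exact: weak_nullZ].
Qed.

Import HBNNSimple.

(** Simple functions are dense in [L2]: weak convergence of a bounded sequence
    can be tested on indicator functions. *)
Lemma weak_null_L2 : (forall E, measurable E -> weak_null g (\1_E)) ->
  forall h, L2 mu h -> weak_null g h.
Proof.
move=> wE.
suff pos h : (forall x, 0 <= h x) -> L2 mu h -> weak_null g h.
  move=> h hL.
  have mh := L2_measurable hL.
  have pL : L2 mu (fun x => Num.max (h x) 0).
    apply: (L2_ae_le _ hL); first by apply: measurable_maxr.
    apply: aeW => x; rewrite ger0_norm ?le_max ?lexx ?orbT//.
    by rewrite ge_max ler_norm normr_ge0.
  have nL : L2 mu (fun x => Num.max (- h x) 0).
    apply: (L2_ae_le _ hL); first by apply: measurable_maxr => //; exact: measurableT_comp.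
    apply: aeW => x; rewrite ger0_norm ?le_max ?lexx ?orbT//.
    by rewrite ge_max -normrN ler_norm normr_ge0.
  have -> : h = (fun x => Num.max (h x) 0 + (-1) * Num.max (- h x) 0).
    apply/funext => x; have [x0|x0] := leP 0 (h x).
      by rewrite max_r ?oppr_le0// mulr0 addr0.
    by rewrite max_l ?oppr_ge0 ?(ltW x0)// add0r mulN1r opprK.
  apply: weak_nullD => //; first exact: L2Z.
  - by apply: pos => // x; rewrite le_max lexx orbT.
  - by apply: weak_nullZ => //; apply: pos => // x; rewrite le_max lexx orbT.
move=> h0 hL; have mh : measurable_fun setT (EFin \o h).
  by apply/measurable_EFinP; exact: L2_measurable hL.
have h0' x : setT x -> (0 <= (EFin \o h) x)%E by rewrite lee_fin.
pose s := nnsfun_approx measurableT mh.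
have sc x : s k x @[k --> \oo] --> h x.
  have := cvg_nnsfun_approx measurableT mh h0' (I : setT x).
  by move/fine_cvg.
have snd x : nondecreasing_seq (fun k => s k x).
  move=> i j ij; have := nd_nnsfun_approx measurableT mh ij.
  by move/lefP.
apply: (@weak_null_dominated (fun k => s k) h h) => //.
- move=> k x; rewrite !ger0_norm//.
  rewrite -(cvg_lim (@Rhausdorff R) (sc x)).
  by apply: nondecreasing_cvgn_le => //; apply/cvg_ex; exists (h x).
- move=> k.
  have -> : (s k : T -> R) = (fun x => \sum_(y <- finmap.enum_fset (fset_set (range (s k))))
      y * \1_((s k) @^-1` [set y]) x).
    apply/funext => x; rewrite fimfunE fsbig_finite//.
  by apply: weak_null_sum => y //; exact: wE.
Qed.

(** Weak convergence can be tested on a pi-system generating the measurable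
    sets, by the pi-lambda theorem. *)
Lemma weak_null_pi_system (G : set (set T)) : setI_closed G ->
  @measurable _ T = <<s G >> -> G setT ->
  (forall E, G E -> weak_null g (\1_E)) -> forall h, L2 mu h -> weak_null g h.
Proof.
move=> GI mG GT Gw; apply: weak_null_L2.
have mGs E : G E -> measurable E by rewrite mG => GE; exact: sub_sigma_algebra.
pose H := [set E | measurable E /\ weak_null g (\1_E)].
suff sH : <<s G >> `<=` H by rewrite mG => E /sH[].
apply: lambda_system_subset => //; last by move=> E GE; split; [exact: mGs|exact: Gw].
split => //.
- by split => //; exact: Gw.
- move=> A B BA [mA wA] [mB wB]; split; first exact: measurableD.
  have -> : (\1_(A `\` B) : T -> R) = (fun x => \1_A x + (-1) * \1_B x).
    apply/funext => x; rewrite !indicE in_setD.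
    case: (boolP (x \in B)) => xB; last by rewrite andbT mulr0 addr0.
    have -> : x \in A by rewrite inE; apply: BA; rewrite inE in xB.
    by rewrite /= mulr1 subrr.
  apply: weak_nullD => //; first exact: L2_indic.
    by apply: L2Z; exact: L2_indic.
  by apply: weak_nullZ => //; exact: L2_indic.
- move=> F ndF FH; split.
    by apply: bigcupT_measurable => k; have [] := FH k.
  apply: (@weak_null_dominated (fun k => \1_(F k)) _ (cst 1)).
  + by move=> k; apply: measurable_indic; have [] := FH k.
  + exact: Lfun_cst.
  + by move=> k x; rewrite indicE normr1; case: (_ \in _); rewrite /= ?normr1 ?normr0.
  + move=> x; have [[k _ Fkx]|nF] := pselect ((\bigcup_k F k) x).
      apply: (@near_eq_cvgn _ _ (cst (\1_(\bigcup_k F k) x))); last exact: cvg_cst.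
      exists k => // j /= kj; rewrite !indicE !mem_set//; first by exists k.
      by have /subsetPset := ndF _ _ kj; apply.
    apply: (@eq_cvgn _ _ (cst (\1_(\bigcup_k F k) x))); last exact: cvg_cst.
    move=> k; rewrite !indicE !memNset// => Fkx; apply: nF; by exists k.
  + by move=> k; have [] := FH k.
Unshelve. all: by end_near.
Qed.

End weak_convergence.

Section strong_convergence.
Context d (T : measurableType d) (R : realType).
Variable mu : probability T R.

(** In a Hilbert space, weak convergence together with convergence of the norms
    is strong convergence. *)
Lemma weak_norm_strong (u : nat -> T -> R) (v : T -> R) :
  (forall n, L2 mu (u n)) -> L2 mu v ->
  weak_null mu (fun n x => u n x - v x) v ->
  norm2 mu (u n) @[n --> \oo] --> norm2 mu v ->
  norm2 mu (fun x => u n x - v x) @[n --> \oo] --> (0 : R).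
Proof.
move=> uL vL wn nn; apply: cvg0_sqr.
have E n : norm2 mu (fun x => u n x - v x) ^+ 2 =
    norm2 mu (u n) ^+ 2 - norm2 mu v ^+ 2 -
    2 * \int[mu]_x ((u n x - v x) * v x).
  have dL : L2 mu (fun x => u n x - v x) by exact: L2B.
  rewrite !norm2_sqrR// -RintegralZl//; last exact: L2_integrable_mul.
  have iu := L2_integrable_sqr (uL n); have iv := L2_integrable_sqr vL.
  have idv := integrableZl measurableT 2 (L2_integrable_mul dL vL).
  rewrite -(RintegralB measurableT iu iv).
  rewrite -(RintegralB measurableT (integrableB measurableT iu iv) idv).
  by apply: eq_Rintegral => x _; ring.
have -> : 0 = norm2 mu v * norm2 mu v - norm2 mu v ^+ 2 - 2 * 0 :> R.
  by rewrite -expr2 subrr mulr0 subr0.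
apply: eq_cvgn E _.
apply: cvgB; last by apply: cvgM => //; exact: cvg_cst.
by apply: cvgB; [exact: cvgM|exact: cvg_cst].
Qed.

End strong_convergence.

(** * Measure-preserving maps and the cut norm *)

Section measure_preserving.
Context d (T : measurableType d) (R : realType).
Variables (mu : probability T R) (phi : T -> T).
Hypothesis mphi : measurable_fun setT phi.
Hypothesis phi_mp : forall S, measurable S -> mu (phi @^-1` S) = mu S.

(** The image measure of [mu] under [phi] is [mu]. *)
Lemma ge0_integral_mp (F : T -> \bar R) : measurable_fun setT F ->
  (forall x, 0 <= F x)%E -> (\int[mu]_x F (phi x) = \int[mu]_x F x)%E.
Proof.
move=> mF F0.
have := @ge0_integral_pushforward _ _ _ _ _ phi mphi mu setT F measurableT mF
  (fun y _ => F0 y).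
rewrite preimage_setT => <-.
by apply: eq_measure_integral => A mA _; exact: phi_mp.
Qed.

Lemma L2_mp f : L2 mu f -> L2 mu (f \o phi) /\ norm2 mu (f \o phi) = norm2 mu f.
Proof.
move=> /[dup] fL /L2P[mf foo].
have E : (\int[mu]_x ((f \o phi) x ^+ 2)%:E = \int[mu]_x (f x ^+ 2)%:E)%E.
  rewrite -(@ge0_integral_mp (fun x => (f x ^+ 2)%:E))//.
    by apply/measurable_EFinP; exact: measurable_funX.
  by move=> x; rewrite lee_fin sqr_ge0.
have fpL : L2 mu (f \o phi).
  by apply/L2P; rewrite E; split => //; exact: measurableT_comp.
split => //; apply/eqP; rewrite -(@eqrXn2 _ 2)// ?norm2_ge0// -eqe.
by rewrite !norm2_sqr// E.
Qed.

Lemma Rintegral_mp f : L2 mu f -> \int[mu]_x f (phi x) = \int[mu]_x f x.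
Proof.
move=> fL; have ifi := L2_integrable fL.
have := @integral_pushforward _ _ _ _ R phi mphi mu setT (EFin \o f)
  (measurable_int mu ifi) _ measurableT.
rewrite preimage_setT => E; rewrite /Rintegral; congr fine.
rewrite -[LHS]E; last exact: L2_integrable (L2_mp fL).1.
by apply: eq_measure_integral => A mA _; exact: phi_mp.
Qed.

Lemma ae_mp (P : T -> Prop) : {ae mu, forall x, P x} ->
  {ae mu, forall x, P (phi x)}.
Proof.
move=> [B [mB B0 PB]]; exists (phi @^-1` B); split.
- by rewrite -[_ @^-1` _]setTI; exact: mphi.
- by rewrite phi_mp.
- by move=> x /= nP; apply: PB.
Qed.

Lemma L2_mp2 w : L2 (mu \x mu)%E w ->
  L2 (mu \x mu)%E (fun p => w (phi p.1, phi p.2)) /\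
  norm2 (mu \x mu)%E (fun p => w (phi p.1, phi p.2)) = norm2 (mu \x mu)%E w.
Proof.
move=> /[dup] wL /L2P[mw woo].
have mw' : measurable_fun setT (fun p => w (phi p.1, phi p.2)).
  apply: measurableT_comp => //; apply: measurable_fun_pair;
    exact: measurableT_comp.
have E : (\int[(mu \x mu)%E]_p (w (phi p.1, phi p.2) ^+ 2)%:E =
    \int[(mu \x mu)%E]_p (w p ^+ 2)%:E)%E.
  rewrite !integral_sqr_rows//=.
  rewrite -(@ge0_integral_mp (fun x => \int[mu]_y (w (x, y) ^+ 2)%:E)%E).
  - apply: eq_integral => x _.
    rewrite -(@ge0_integral_mp (fun y => (w (phi x, y) ^+ 2)%:E)%E)//.
      apply/measurable_EFinP; apply: measurable_funX.
      exact: measurable_fun_pair2.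
    by move=> y; rewrite lee_fin sqr_ge0.
  - exact: measurable_sqr_row.
  - by move=> x; apply: integral_ge0 => y _; rewrite lee_fin sqr_ge0.
have wL' : L2 (mu \x mu)%E (fun p => w (phi p.1, phi p.2)).
  by apply/L2P; rewrite E.
split => //; apply/eqP; rewrite -(@eqrXn2 _ 2)// ?norm2_ge0// -eqe.
by rewrite !norm2_sqr// E.
Qed.

End measure_preserving.

Section cut_norm.
Variable R : realType.
Local Notation mu2 := (@muI R \x @muI R)%E.
Implicit Types u w : R * R -> R.

Lemma muI_pair_ae : {ae mu2, forall p, I01 p.1 /\ I01 p.2}.
Proof.
have mC : measurable (~` @I01 R) by apply: measurableC; exact: measurable_I01.
have C0 : muI (~` @I01 R) = 0%E by rewrite /= muIE setICl measure0.
have n1 : mu2.-negligible (~` I01 `*` setT).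
  exists (~` I01 `*` setT); split => //; first exact: measurableX.
  by rewrite product_measure1E// [X in (X * _)%E]C0 mul0e.
have n2 : mu2.-negligible (setT `*` ~` I01).
  exists (setT `*` ~` I01); split => //; first exact: measurableX.
  by rewrite product_measure1E// [X in (_ * X)%E]C0 mule0.
apply: negligibleS (negligibleU n1 n2) => -[x y] /= /not_andP[h|h].
  by left.
by right.
Qed.

Lemma cut_norm_has_sup u : L2 mu2 u -> has_sup [set r | exists S T : set R,
    [/\ measurable S, measurable T, S `<=` I01, T `<=` I01 &
        r = `| \int[mu2]_(p in S `*` T) u p | ] ].
Proof.
move=> uL; have iu := L2_integrable uL; split.
  exists `|\int[mu2]_(p in set0 `*` set0) u p|; exists set0, set0; split => //.
exists (\int[mu2]_p `|u p|) => _ [S [T [mS mT _ _ ->]]].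
have iuST : mu2.-integrable (S `*` T) (EFin \o u).
  by apply: (integrableS measurableT) => //; exact: measurableX.
apply: le_trans (le_normr_Rintegral _ iuST) _; first exact: measurableX.
rewrite Rintegral_mkcond; apply: le_Rintegral => //.
- have := integrable_abse iuST.
  move/(integrable_mkcond _ (measurableX mS mT)).
  apply: eq_integrable => // p _.
  by rewrite /= restrict_EFin.
- exact: (integrable_abse iu).
- move=> p _; rewrite patchE; case: ifP => _; first exact: lexx.
  exact: normr_ge0.
Qed.

Lemma cut_norm_ge0 u : L2 mu2 u -> 0 <= cut_norm u.
Proof.
move=> uL; have [[r [S [T [? ? ? ? rE]]]] ub] := cut_norm_has_sup uL.
apply: (@le_trans _ _ r); first by rewrite rE.
by apply: ub_le_sup => //; exists S, T.
Qed.

(** The cut norm only sees rectangles inside the square; these suffice, since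
    the square has full measure. *)
Lemma cut_norm_rectangle u S T : L2 mu2 u -> measurable S -> measurable T ->
  `|\int[mu2]_p (u p * \1_(S `*` T) p)| <= cut_norm u.
Proof.
move=> uL mS mT; have [_ ub] := cut_norm_has_sup uL.
apply: ub_le_sup => //; exists (S `&` I01), (T `&` I01).
have mI := @measurable_I01 R.
have mS' := measurableI _ _ mS mI; have mT' := measurableI _ _ mT mI.
split => //; congr (`| _ |); rewrite [RHS]Rintegral_mkcond /Rintegral; congr fine.
have mu := L2_measurable uL.
apply: ae_eq_integral => //.
- apply/measurable_EFinP; apply: measurable_funM => //.
  by apply: measurable_indic; exact: measurableX.
- apply/measurable_EFinP.
  apply: (measurable_restrictT u (measurableX mS' mT')).1.
  exact: measurable_funTS.
- apply: filterS muI_pair_ae => -[x y] /= [Ix Iy] _; congr EFin.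
  rewrite patchE indicE.
  have -> : ((x, y) \in (S `&` I01) `*` (T `&` I01)) = ((x, y) \in S `*` T).
    by apply/idP/idP; rewrite !inE /=; [case=> [[? _] [? _]]|case].
  by case: ifP; rewrite ?mulr1 ?mulr0.
Qed.

(** Convergence in cut norm tests a sequence of kernels against rectangles,
    which generate the measurable subsets of the square. *)
Lemma cut_norm_strong (u : nat -> R * R -> R) w :
  (forall n, L2 mu2 (u n)) -> L2 mu2 w ->
  cut_norm (fun p => u n p - w p) @[n --> \oo] --> (0 : R) ->
  norm2 mu2 (u n) @[n --> \oo] --> norm2 mu2 w ->
  norm2 mu2 (fun p => u n p - w p) @[n --> \oo] --> (0 : R).
Proof.
move=> uL wL cutc normc; apply: weak_norm_strong => //.
have dL n : L2 mu2 (fun p => u n p - w p) by exact: L2B.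
have [K Kub] : exists K, forall n, norm2 mu2 (u n) <= K.
  have /cvg_seq_bounded[M [Mr HM]] : cvgn (fun n => norm2 mu2 (u n)).
    by apply/cvg_ex; exists (norm2 mu2 w).
  exists (M + 1) => n; have := HM (M + 1); rewrite ltrDl ltr01 => /(_ isT) /(_ n I).
  exact/le_trans/ler_norm.
apply: (@weak_null_pi_system _ _ _ _ _ (K + norm2 mu2 w) dL _
  [set A `*` B | A in measurable & B in measurable]) => //.
- move=> n; apply: (@le_trans _ _ (norm2 mu2 (u n) + norm2 mu2 w)).
    rewrite -(norm2N mu2 w); apply: norm2_triangle => //; exact: L2N.
  by rewrite lerD2r.
- move=> _ _ [A mA [B mB <-]] [C mC [D mD <-]].
  exists (A `&` C); first exact: measurableI.
  exists (B `&` D); first exact: measurableI.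
  by rewrite setXI.
- exact: measurable_prod_measurableType.
- by exists setT => //; exists setT => //; rewrite setXTT.
- move=> _ [A mA [B mB <-]].
  apply/cvgr0Pnorm_lt => e e0.
  move/cvgr0Pnorm_lt : cutc => /(_ _ e0); apply: filterS => n.
  apply: le_lt_trans; apply: le_trans (ler_norm _).
  exact: cut_norm_rectangle.
Qed.

End cut_norm.

(** * Approximate minimizers of strongly convex functions *)

Section one_dimensional_calculus.
Variables (R : realType) (A : set R).
Hypothesis Acv : convex_set (A : set R^o).
Implicit Types (F G : R -> R) (L : R).

Lemma is_derive_withinP F a l : is_derive_within A F a l ->
  forall e, 0 < e -> exists2 r, 0 < r & forall x, A x -> x != a ->
    `|a - x| < r -> `|l - (F x - F a) / (x - a)| < e.
Proof.
move=> /cvgrPdist_lt h e /h; rewrite near_withinE => /nbhs_ballP[r /= r0 H].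
by exists r => // x Ax xa axr; apply: H.
Qed.

Lemma is_derive_withinB F G a l m : is_derive_within A F a l ->
  is_derive_within A G a m ->
  is_derive_within A (fun x => F x - G x) a (l - m).
Proof.
move=> dF dG; rewrite /is_derive_within.
rewrite (_ : (fun x => _) = (fun x => (F x - F a) / (x - a) -
    (G x - G a) / (x - a))); first exact: cvgB.
by apply/funext => x; rewrite -mulrBl; congr (_ / _); ring.
Qed.

Lemma is_derive_within_continuous F a l : is_derive_within A F a l ->
  F x @[x --> within A (nbhs a)] --> F a.
Proof.
move=> dF; apply/cvgrPdist_lt => e e0.
have [r r0 H] := is_derive_withinP dF ltr01.
rewrite near_withinE; apply/nbhs_ballP.
exists (Num.min r (e / (`|l| + 1))) => /=.
  by rewrite lt_min r0 divr_gt0// ltr_wpDl.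
move=> x; rewrite /ball/= lt_min => /andP[xr xe] Ax.
have [->|xa] := eqVneq x a; first by rewrite subrr normr0.
have xa0 : x - a != 0 by rewrite subr_eq0.
have := H x Ax xa xr; set q := (F x - F a) / (x - a) => hq.
have -> : F a - F x = q * (a - x) by rewrite /q; field.
rewrite normrM.
have ql : `|q| <= `|l| + 1.
  have -> : q = l - (l - q) by ring.
  by rewrite (le_trans (ler_normB _ _))// lerD2l ltW.
have l1 : 0 < `|l| + 1 by rewrite ltr_wpDl.
apply: (@le_lt_trans _ _ ((`|l| + 1) * `|a - x|)); first by rewrite ler_wpM2r.
by rewrite mulrC -ltr_pdivlMr.
Qed.

Lemma is_derive_within_interior F a l (x0 x1 : R) : A x0 -> A x1 ->
  a \in `]x0, x1[ -> is_derive_within A F a l -> is_derive a 1 F l.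
Proof.
move=> Ax0 Ax1; rewrite in_itv/= => /andP[xa ax] dF.
have c : h^-1 *: ((F \o shift a) (h *: (1 : R)) - F a) @[h --> (0 : R)^'] --> l.
  apply/cvgrPdist_lt => e e0; have [r r0 H] := is_derive_withinP dF e0.
  pose s := Num.min r (Num.min (a - x0) (x1 - a)).
  apply/nbhs_ballP; exists s => /=.
    by rewrite !lt_min r0 !subr_gt0 xa.
  move=> h; rewrite /ball/= sub0r normrN !lt_min => /andP[hr /andP[h0 h1]] hn.
  have E : (F (h + a) - F a) / (h + a - a) = h^-1 * (F (h + a) - F a).
    by rewrite addrK mulrC.
  rewrite -[X in _ - X]/(h^-1 * (F (h * 1 + a) - F a)) mulr1 -E.
  apply: H.
  - apply: (convex_set_between Acv Ax0 Ax1).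
      by have := ler_norm (- h); rewrite normrN; lra.
    by have := ler_norm h; lra.
  - by apply/eqP => ha; move/eqP: hn; apply; lra.
  - by rewrite opprD addrCA subrr addr0 normrN.
apply: DeriveDef; first by apply/cvg_ex; exists l.
exact: (cvg_lim (@Rhausdorff R) c).
Qed.

(** The mean value inequality for derivatives relative to [A]: segments with
    end points in [A] lie in [A], and only their interior matters. *)
Lemma mean_value_within H dH L : (forall a, A a -> is_derive_within A H a (dH a)) ->
  (forall a, A a -> `|dH a| <= L) ->
  forall a a', A a -> A a' -> `|H a - H a'| <= L * `|a - a'|.
Proof.
move=> dHH dHL a a' Aa Aa'.
wlog lt : a a' Aa Aa' / a' < a.
  move=> W; have [aa|aa|->] := ltgtP a' a.
  - exact: W.
  - by rewrite distrC (distrC a); exact: W.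
  - by rewrite !subrr normr0 mulr0.
have Ab z : z \in `[a', a] -> A z.
  by rewrite in_itv/= => /andP[? ?]; apply: (convex_set_between Acv Aa' Aa).
have [||c cin E] := @MVT _ H dH a' a lt.
- move=> x xin; apply: (is_derive_within_interior Aa' Aa xin).
  by apply: dHH; apply: Ab; apply: subset_itv_oo_cc xin.
- apply/subspace_continuousP => x xin.
  have := is_derive_within_continuous (dHH x (Ab x xin)).
  apply: cvg_trans; apply: cvg_app.
  move=> B nB; have {}nB : nbhs x [set y | A y -> B y] by exact: nB.
  suff : nbhs x [set y | `[a', a]%classic y -> B y] by [].
  by apply: filterS nB => y AB yin; apply: AB; exact: Ab.
rewrite E normrM ler_wpM2r//; apply: dHL; apply: Ab.
exact: subset_itv_oo_cc cin.
Qed.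

(** Strong convexity at distance [t] from an approximate minimizer of [F]
    yields a quadratic lower bound on [F beta - F alpha] up to [eps / t]; the
    same bound holds for [G] at its minimizer.  Summing them, the difference
    [F - G] is controlled by the mean value inequality. *)
Lemma strongly_convex_minimizers F G dF dG (ell L eps t alpha beta : R) :
  (forall a, A a -> is_derive_within A F a (dF a)) ->
  (forall a, A a -> is_derive_within A G a (dG a)) ->
  (forall a, A a -> `|dF a - dG a| <= L) ->
  (forall a a' s, A a -> A a' -> 0 <= s -> s <= 1 ->
    F (s * a + (1 - s) * a') <= s * F a + (1 - s) * F a' -
      ell / 2 * s * (1 - s) * `|a - a'| ^+ 2) ->
  (forall a a' s, A a -> A a' -> 0 <= s -> s <= 1 ->
    G (s * a + (1 - s) * a') <= s * G a + (1 - s) * G a' -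
      ell / 2 * s * (1 - s) * `|a - a'| ^+ 2) ->
  A alpha -> A beta -> 0 < t -> t <= 1 ->
  (forall a, A a -> F alpha <= F a + eps) ->
  (forall a, A a -> G beta <= G a) ->
  ell * (1 - t) * (alpha - beta) ^+ 2 <= L * `|alpha - beta| + eps / t.
Proof.
move=> dFF dGG dL cF cG Aal Abe t0 t1 mF mG.
have Hm := mean_value_within (fun a Aa => is_derive_withinB (dFF a Aa) (dGG a Aa))
  dL Abe Aal.
have hF := cF beta alpha t Abe Aal (ltW t0) t1.
have hG := cG alpha beta t Aal Abe (ltW t0) t1.
have Ac a a' : A a -> A a' -> A (t * a + (1 - t) * a').
  by move=> Aa Aa'; apply: (convex_set_combination Acv) => //; exact: ltW.
have {}hF := le_trans (mF _ (Ac _ _ Abe Aal)) (lerD hF (lexx eps)).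
have {}hG := le_trans (mG _ (Ac _ _ Aal Abe)) hG.
rewrite distrC (distrC beta) in Hm hF.
rewrite !real_normK ?num_real// in hF hG.
have {}Hm : F beta - G beta - (F alpha - G alpha) <= L * `|alpha - beta|.
  by apply: le_trans Hm; rewrite distrC ler_norm.
set D := (alpha - beta) ^+ 2 in hF hG *.
rewrite -(ler_pM2l t0).
have -> : t * (L * `|alpha - beta| + eps / t) = t * (L * `|alpha - beta|) + eps.
  by field; rewrite gt_eqF.
have : t * (F beta - G beta - (F alpha - G alpha)) <= t * (L * `|alpha - beta|).
  by rewrite ler_wpM2l// ltW.
lra.
Qed.

End one_dimensional_calculus.

(** * Fixed points of nonlinear integral equations *)

Section fixed_point.
Context d (T : measurableType d) (R : realType).
Variable mu : probability T R.
Variables (w : T * T -> R) (F : T -> R -> R) (c0 k : R).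
Hypothesis wL : L2 (mu \x mu)%E w.
Hypothesis mF : forall z : T -> R, measurable_fun setT z ->
  measurable_fun setT (fun y => F y (z y)).
Hypothesis c00 : 0 <= c0.
Hypothesis Fb : forall y z, `|F y z| <= c0.
Hypothesis k0 : 0 <= k.
Hypothesis Flip : forall y z z', `|F y z - F y z'| <= k * `|z - z'|.
Hypothesis contraction : k * norm2 (mu \x mu)%E w < 1.

Let E : set T := [set x | (\int[mu]_y (w (x, y) ^+ 2)%:E)%E \is a fin_num].

Let mE : measurable E.
Proof.
rewrite /E -[X in measurable X]setTI; apply: emeasurable_fin_num => //.
exact: measurable_sqr_row (L2_measurable wL).
Qed.

Let EL x : E x -> L2 mu (fun y => w (x, y)).
Proof.
move=> Ex; apply/L2P; split; first exact: measurable_fun_pair2 (L2_measurable wL).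
by rewrite ltey_eq Ex.
Qed.

Let aeE : {ae mu, forall x, E x}.
Proof.
apply: filterS (ae_L2_row wL) => x /L2P[_]; rewrite /E/= ge0_fin_numE//.
by apply: integral_ge0 => y _; rewrite lee_fin sqr_ge0.
Qed.

(* The operator is cut off outside [E], where its kernel is not square
   integrable, so that the estimates below hold at every point. *)
Let Top (g : T -> R) x := \1_E x * kernel_op mu w g x.

Let Top_ae g : {ae mu, forall x, Top g x = kernel_op mu w g x}.
Proof.
by apply: filterS aeE => x Ex; rewrite /Top indicE mem_set// mul1r.
Qed.

Let mTop g : L2 mu g -> measurable_fun setT (Top g).
Proof.
move=> gL; apply: measurable_funM; first exact: measurable_indic.
exact: (measurable_kernel_op wL gL).
Qed.

Let Top_le g x : L2 mu g -> `|Top g x| <= row_norm mu w x * norm2 mu g.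
Proof.
move=> gL; rewrite /Top indicE; case: (boolP (x \in E)) => xE.
  by rewrite mul1r; apply: kernel_op_row_le => //; apply: EL; rewrite inE in xE.
by rewrite mul0r normr0 mulr_ge0// norm2_ge0.
Qed.

Let TopB g g' x : L2 mu g -> L2 mu g' ->
  Top g x - Top g' x = Top (fun y => g y - g' y) x.
Proof.
move=> gL gL'; rewrite /Top indicE; case: (boolP (x \in E)) => xE; last first.
  by rewrite !mul0r subrr.
have wxL := EL (set_mem xE).
rewrite !mul1r /kernel_op -RintegralB//; [|exact: L2_integrable_mul..].
by apply: eq_Rintegral => y _; rewrite mulrBr.
Qed.

Let L2_F z : measurable_fun setT z -> L2 mu (fun y => F y (z y)).
Proof. by move=> mz; apply: (L2_bounded (c := c0)); [exact: mF|exact: aeW]. Qed.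

Let norm_F z : measurable_fun setT z -> norm2 mu (fun y => F y (z y)) <= c0.
Proof.
move=> mz; rewrite -[leRHS]ger0_norm//.
by apply: norm2_bounded; [exact: mF|exact: aeW].
Qed.

Let norm_FB z z' : L2 mu z -> L2 mu z' ->
  norm2 mu (fun y => F y (z y) - F y (z' y)) <= k * norm2 mu (fun y => z y - z' y).
Proof.
move=> zL zL'; have mz := L2_measurable zL; have mz' := L2_measurable zL'.
have dL : L2 mu (fun y => z y - z' y) by exact: L2B.
apply: norm2_le_sqr; first by apply: L2B; exact: L2_F.
  by rewrite mulr_ge0// norm2_ge0.
rewrite exprMn EFinM norm2_sqr// -integralZl//; last exact: L2_integrable_sqr.
under [leRHS]eq_integral do rewrite -EFinM -exprMn.
apply: ae_le_integral_sqr.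
- by apply: measurable_funB; exact: mF.
- by apply: measurable_funX; apply: measurable_funM => //; exact: measurable_funB.
- apply: aeW => y; apply: ler_sqr_abs.
  by apply: le_trans (Flip _ _ _) _; rewrite normrM (ger0_norm k0).
- by move=> y; exact: sqr_ge0.
Qed.

Let norm_Top g : L2 mu g -> norm2 mu (Top g) <= norm2 (mu \x mu)%E w * norm2 mu g.
Proof.
move=> gL; apply: le_trans (norm2_kernel_op wL gL).
rewrite le_eqVlt; apply/orP; left; apply/eqP.
by apply: norm2_ae_eq (Top_ae g); [exact: mTop|exact: L2_kernel_op].
Qed.

Let z_ := fix z n := if n is n'.+1 then Top (fun y => F y (z n' y)) else cst 0.

Let z_L n : L2 mu (z_ n).
Proof.
elim: n => [|n IH]; first exact: Lfun_cst.
have FL := L2_F (L2_measurable IH).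
apply: (L2_ae_eq _ (L2_kernel_op wL FL) (Top_ae _)); exact: mTop.
Qed.

Let d_ n := norm2 mu (fun y => z_ n.+1 y - z_ n y).
Let q := k * norm2 (mu \x mu)%E w.

Let d_le n : d_ n <= q ^+ n * d_ 0%N.
Proof.
elim: n => [|n IH]; first by rewrite expr0 mul1r.
have FL m := L2_F (L2_measurable (z_L m)).
have -> : d_ n.+1 = norm2 mu (Top (fun y => F y (z_ n.+1 y) - F y (z_ n y))).
  by congr norm2; apply/funext => x; rewrite -TopB.
apply: le_trans (norm_Top (L2B (FL _) (FL _))) _.
rewrite exprS -mulrA; apply: (@le_trans _ _ (q * d_ n)).
  rewrite /q (mulrC k) -mulrA ler_wpM2l ?norm2_ge0//.
  exact: (norm_FB (z_L n.+1) (z_L n)).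
by rewrite ler_wpM2l// /q mulr_ge0 ?norm2_ge0.
Qed.

Let z_cvg x : cvgn (fun n => z_ n x).
Proof.
pose C := row_norm mu w x * (k * d_ 0%N).
have q0 : 0 <= q by rewrite /q mulr_ge0 ?norm2_ge0.
have FL m := L2_F (L2_measurable (z_L m)).
have step n : `|z_ n.+2 x - z_ n.+1 x| <= geometric C q n.
  rewrite (_ : z_ n.+2 x - z_ n.+1 x =
    Top (fun y => F y (z_ n.+1 y) - F y (z_ n y)) x); last by rewrite -TopB.
  have H := Top_le x (L2B (FL n.+1) (FL n)); apply: le_trans H _.
  rewrite /geometric /C/= -!mulrA ler_wpM2l ?norm2_ge0//.
  have H := norm_FB (z_L n.+1) (z_L n); apply: le_trans H _.
  by rewrite ler_wpM2l// mulrC; exact: d_le.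
have cs : cvgn (series (fun n => z_ n.+2 x - z_ n.+1 x)).
  apply: normed_cvg.
  apply: (@series_le_cvg _ _ (geometric C q)) => //.
  - by move=> n; exact: normr_ge0.
  - by move=> n; exact: (le_trans (normr_ge0 _) (step n)).
  - by apply: is_cvg_geometric_series; rewrite ger0_norm.
have : cvgn (fun n => z_ n.+1 x).
  rewrite (_ : (fun n => _) = (fun n => z_ 1%N x + series (fun n => z_ n.+2 x - z_ n.+1 x) n)).
    by apply: is_cvgD => //; exact: is_cvg_cst.
  apply/funext => n; rewrite /series/=.
  by rewrite (telescope_sumr (fun n => z_ n.+1 x))// addrC subrK.
by move=> /cvg_ex[l zl]; apply/cvg_ex; exists l; rewrite -(cvg_shiftS (fun n => z_ n x)).
Qed.

(** Picard iteration.  The increments decrease geometrically in [L2], and the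
    Cauchy-Schwarz inequality in the rows of the kernel turns this into
    pointwise convergence of the iterates.  They are dominated by a multiple of
    [row_norm], so that the limit is also a limit in [L2], and the fixed-point
    equation passes to the limit. *)
Lemma kernel_fixed_point : exists2 z, L2 mu z &
  {ae mu, forall x, z x = kernel_op mu w (fun y => F y (z y)) x}.
Proof.
pose z x := limn (fun n => z_ n x).
have zc x : z_ n x @[n --> \oo] --> z x by exact: z_cvg.
have [rL _] := L2_row_norm wL.
have [zL zn] : L2 mu z /\ norm2 mu (fun x => z x - z_ n x) @[n --> \oo] --> (0 : R).
  apply: (norm2_dominated_cvg (H := fun x => c0 * row_norm mu w x)) => //.
  - by move=> n; exact: L2_measurable (z_L n).
  - exact: L2Z.
  - move=> [|n] x; first by rewrite normr0.
    have FL := L2_F (L2_measurable (z_L n)).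
    have H := Top_le x FL; apply: le_trans H _; apply: le_trans (ler_norm _).
    rewrite mulrC ler_wpM2r ?norm2_ge0//.
    by apply: norm_F; exact: L2_measurable (z_L n).
have FL m := L2_F (L2_measurable (z_L m)); have FzL := L2_F (L2_measurable zL).
exists z => //; apply: filterS (Top_ae (fun y => F y (z y))) => x <-.
have c1 : z_ n.+1 x @[n --> \oo] --> z x by rewrite (cvg_shiftS (fun n => z_ n x)).
have c2 : z_ n.+1 x @[n --> \oo] --> Top (fun y => F y (z y)) x.
  apply/cvgrPdist_lt => e e0.
  have r0 : 0 < row_norm mu w x * k + 1.
    by rewrite ltr_wpDl// mulr_ge0 ?norm2_ge0.
  have /cvgr0Pnorm_lt/(_ _ (divr_gt0 e0 r0)) := zn; apply: filterS => n hn.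
  rewrite (_ : _ - _ = Top (fun y => F y (z y) - F y (z_ n y)) x);
    last by rewrite -TopB.
  have H := Top_le x (L2B FzL (FL n)); apply: le_lt_trans H _.
  rewrite ltr_pdivlMr// in hn; apply: le_lt_trans hn.
  apply: (@le_trans _ _ (row_norm mu w x * (k * norm2 mu (fun y => z y - z_ n y)))).
    by rewrite ler_wpM2l ?norm2_ge0//; exact: (norm_FB zL (z_L n)).
  rewrite mulrA mulrC ger0_norm ?norm2_ge0//.
  by rewrite ler_wpM2l ?norm2_ge0// lerDl.
exact: (cvg_unique (@Rhausdorff R) c1 c2).
Qed.

End fixed_point.

(** * Independent noise *)

Section finite_sums.
Variables (R : realFieldType) (I : finType).
Implicit Types x y : I -> R.

(** Lagrange's identity. *)
Lemma sum_cauchy_schwarz x y :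
  (\sum_i x i * y i) ^+ 2 <= (\sum_i x i ^+ 2) * (\sum_i y i ^+ 2).
Proof.
have E1 : (\sum_i x i * y i) ^+ 2 = \sum_i \sum_j (x i * y i) * (x j * y j).
  by rewrite expr2 mulr_suml; apply: eq_bigr => i _; rewrite mulr_sumr.
have E2 : (\sum_i x i ^+ 2) * (\sum_i y i ^+ 2) =
    \sum_i \sum_j x i ^+ 2 * y j ^+ 2.
  by rewrite mulr_suml; apply: eq_bigr => i _; rewrite mulr_sumr.
have E3 : (\sum_i x i ^+ 2) * (\sum_i y i ^+ 2) =
    \sum_i \sum_j x j ^+ 2 * y i ^+ 2.
  by rewrite E2 exchange_big.
rewrite -subr_ge0 -(pmulr_rge0 _ (ltr0n R 2)).
rewrite (_ : 2 * _ = \sum_i \sum_j (x i * y j - x j * y i) ^+ 2).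
  by apply: sumr_ge0 => i _; apply: sumr_ge0 => j _; exact: sqr_ge0.
rewrite mulrBr (mulr_natl _ 2) mulr2n {1}E2 E3 E1 mulr_sumr -big_split /= -sumrB.
apply: eq_bigr => i _; rewrite mulr_sumr -big_split /= -sumrB.
by apply: eq_bigr => j _; ring.
Qed.

End finite_sums.

Section integral_sums.
Context d (T : measurableType d) (R : realType).
Variable mu : {measure set T -> \bar R}.

Lemma L2_sum I (r : seq I) (f : I -> T -> R) : (forall i, L2 mu (f i)) ->
  L2 mu (fun x => \sum_(i <- r) f i x).
Proof.
move=> fL; elim: r => [|i r IH].
  apply/L2P; under eq_fun do rewrite big_nil; split => //.
  under eq_integral do rewrite big_nil expr0n/=.
  by rewrite integral0.
have -> : (fun x : T => \sum_(j <- i :: r) f j x) =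
    (fun x => f i x + \sum_(j <- r) f j x).
  by apply/funext => x; rewrite big_cons.
exact: L2D.
Qed.

Lemma Rintegral_sum I (r : seq I) (f : I -> T -> R) :
  (forall i, mu.-integrable setT (EFin \o f i)) ->
  mu.-integrable setT (EFin \o (fun x => \sum_(i <- r) f i x)) /\
  \int[mu]_x (\sum_(i <- r) f i x) = \sum_(i <- r) \int[mu]_x f i x.
Proof.
move=> fi; elim: r => [|i r [IH1 IH2]].
  rewrite big_nil; have E : (fun x : T => \sum_(i <- [::]) f i x) = cst 0.
    by apply/funext => x; rewrite big_nil.
  rewrite E; split; first exact: integrable0.
  by rewrite Rintegral_cst// mul0r.
have E : (fun x : T => \sum_(j <- i :: r) f j x) =
    (fun x => f i x + \sum_(j <- r) f j x).
  by apply/funext => x; rewrite big_cons.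
rewrite E; split; first exact: (integrableD measurableT (fi i) IH1).
by rewrite RintegralD// IH2 big_cons.
Qed.

End integral_sums.

Lemma integral_sqr_law (R : realType) (mu0 : probability R R) d
    (Omega : measurableType d) (P : probability Omega R) (X : {RV P >-> R}) :
  (forall B, measurable B -> distribution P X B = mu0 B) ->
  (\int[P]_om (X om ^+ 2)%:E = \int[mu0]_x (x ^+ 2)%:E)%E.
Proof.
move=> X_law; have m2 : measurable_fun setT (fun x : R => (x ^+ 2)%:E).
  by apply/measurable_EFinP; exact: measurable_funX.
have := @ge0_integral_pushforward _ _ _ _ _ X (measurable_funP X) P setT
  _ measurableT m2 (fun x _ => _).
rewrite preimage_setT => <-; last by move=> y; rewrite lee_fin sqr_ge0.
by apply: eq_measure_integral => A mA _; exact: X_law.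
Qed.

Section iid_noise.
Context (R : realType) (mu0 : probability R R).
Hypothesis mu0_int : mu0.-integrable setT (fun x : R => x%:E).
Hypothesis mu0_mean : (\int[mu0]_x x%:E = 0)%E.
Hypothesis mu0_moment2 : (\int[mu0]_x (x ^+ 2)%:E < +oo)%E.
Context d (Omega : measurableType d) (P : probability Omega R) (N : nat).
Variable xi : 'I_N -> {RV P >-> R}.
Hypothesis xi_iid : iid_law mu0 xi.

Definition second_moment : R := \int[mu0]_x (x ^+ 2).

Lemma second_moment_ge0 : 0 <= second_moment.
Proof. by apply: Rintegral_ge0 => x _; exact: sqr_ge0. Qed.

Lemma L2_idfun : L2 mu0 (fun x : R => x).
Proof. by apply/L2P; split. Qed.

Lemma integral_sqr_xi i :
  (\int[P]_om (xi i om ^+ 2)%:E = second_moment%:E)%E.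
Proof.
rewrite (integral_sqr_law (xi_iid.1 i)) /second_moment /Rintegral fineK//.
by rewrite ge0_fin_numE// integral_ge0// => x _; rewrite lee_fin sqr_ge0.
Qed.

Lemma L2_xi i : L2 P (xi i).
Proof.
by apply/L2P; split; [exact: measurable_funP|rewrite integral_sqr_xi ltry].
Qed.

(** The product rule for the family in which only two events are proper. *)
Lemma pair_law i j : i != j -> forall S : set (R * R), measurable S ->
  P ((fun om => (xi i om, xi j om)) @^-1` S) = (mu0 \x mu0)%E S.
Proof.
move=> ij S mS.
have mpair : measurable_fun setT (fun om => (xi i om, xi j om)).
  by apply: measurable_fun_pair; exact: measurable_funP.
pose X : {mfun Omega >-> (R * R)%type} := mfun_Sub (mem_set mpair).
apply/esym; apply: (@product_measure_unique _ _ _ _ _ mu0 mu0 (distribution P X)) => //.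
move=> A B mA mB.
pose C k := if k == i then A else if k == j then B else setT.
have mC k : measurable (C k) by rewrite /C; case: ifP => // _; case: ifP.
have ji : (j == i) = false by rewrite eq_sym; exact: negbTE.
have := xi_iid.2 C mC.
have -> : [set om | forall k, C k (xi k om)] = X @^-1` (A `*` B).
  apply/seteqP; split => om /=.
    move=> H; split; first by have := H i; rewrite /C eqxx.
    by have := H j; rewrite /C ji eqxx.
  move=> [HA HB] k; rewrite /C; case: eqVneq => [->//|_].
  by case: eqVneq => [->//|_].
move=> H; apply: (etrans H) => {H}.
rewrite (bigD1 i)//= (bigD1 j)/=; last by rewrite ji.
rewrite big1 ?mule1; last first.
  move=> k /andP[ki kj]; rewrite /C (negbTE ki) (negbTE kj) preimage_setT.
  exact: probability_setT.
rewrite /C eqxx ji eqxx.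
by congr (_ * _)%E; exact: xi_iid.1.
Qed.

Lemma integral_xi_mul i j :
  \int[P]_om (xi i om * xi j om) = if i == j then second_moment else 0.
Proof.
case: eqVneq => [<-|ij].
  by rewrite /Rintegral -[RHS]/(fine second_moment%:E) -(integral_sqr_xi i).
have mpair : measurable_fun setT (fun om => (xi i om, xi j om)).
  by apply: measurable_fun_pair; exact: measurable_funP.
have iij := L2_integrable_mul (L2_xi i) (L2_xi j).
have mm : measurable_fun setT (fun p : R * R => (p.1 * p.2)%:E).
  by apply/measurable_EFinP; apply: measurable_funM.
have := @integral_pushforward _ _ _ _ R _ mpair P setT
  (fun p : R * R => (p.1 * p.2)%:E) mm _ measurableT.
rewrite preimage_setT => E; rewrite /Rintegral -[X in fine X]E; last exact: iij.
rewrite (@eq_measure_integral _ _ _ _ (mu0 \x mu0)%E); last first.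
  by move=> A mA _; exact: pair_law.
have L1 : L2 (mu0 \x mu0)%E (fun p : R * R => p.1).
  apply/L2P; split; first exact: measurable_fst.
  have -> := @integral_sqr_rows _ _ _ _ R mu0 mu0 (fun p => p.1) measurable_fst.
  move: mu0_moment2; congr (_ < _)%E; apply: eq_integral => x _.
  rewrite (integral_cst mu0 measurableT (x ^+ 2)%:E).
  rewrite [X in (_ * X)%E](_ : _ = 1%E) ?mule1//; exact: probability_setT.
have := L2_integrable_mul L1 (L2_snd mu0 L2_idfun) => ip.
rewrite -(integral12_prod_meas1 ip)/= /fubini_F /=.
under eq_integral.
  move=> x _; under eq_integral do rewrite EFinM.
  rewrite integralZl//  mu0_mean mule0.
  over.
by rewrite integral0.
Qed.

(** The noise terms are uncorrelated, hence orthogonal in [L2]. *)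
Lemma integral_sqr_noise (c : 'I_N -> R) :
  (\int[P]_om ((\sum_j c j * xi j om) ^+ 2)%:E =
    (second_moment * \sum_j c j ^+ 2)%:E)%E.
Proof.
have SL : L2 P (fun om => \sum_j c j * xi j om).
  by apply: L2_sum => j; apply: L2Z; exact: L2_xi.
rewrite -norm2_sqr// norm2_sqrR//; congr EFin.
have xL j : L2 P (fun om => c j * xi j om) by apply: L2Z; exact: L2_xi.
have I2 i j := L2_integrable_mul (xL i) (xL j).
transitivity (\int[P]_om (\sum_i \sum_j (c i * xi i om) * (c j * xi j om))).
  apply: eq_Rintegral => om _; rewrite expr2 mulr_suml.
  by apply: eq_bigr => i _; rewrite mulr_sumr.
rewrite (Rintegral_sum _ _).2; last first.
  by move=> i; exact: (Rintegral_sum _ (I2 i)).1.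
rewrite mulr_sumr; apply: eq_bigr => i _.
rewrite (Rintegral_sum _ (I2 i)).2 (bigD1 i)//= big1 ?addr0; last first.
  move=> j ji.
  transitivity (c i * c j * \int[P]_om (xi i om * xi j om)).
    rewrite -RintegralZl//; last exact: (L2_integrable_mul (L2_xi i) (L2_xi j)).
    by apply: eq_Rintegral => om _; ring.
  by rewrite integral_xi_mul eq_sym (negbTE ji) mulr0.
transitivity (c i * c i * \int[P]_om (xi i om * xi i om)).
  rewrite -RintegralZl//; last exact: (L2_integrable_mul (L2_xi i) (L2_xi i)).
  by apply: eq_Rintegral => om _; ring.
by rewrite integral_xi_mul eqxx -expr2 mulrC.
Qed.

End iid_noise.

(** * Finite aggregates under a deviation of one player *)

Section finite_aggregates.
Variables (R : realType) (A : set R) (b : R -> R -> R) (c_z c_0 : R).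
Variables (N : nat) (W : 'M[R]_N).
Hypothesis N0 : (0 < N)%N.
Hypothesis c_00 : 0 <= c_0.
Hypothesis b_lip : forall a z z', A a ->
  (b a z - b a z') ^+ 2 <= c_z * (z - z') ^+ 2.
Hypothesis b_bounded : forall a z, A a -> `|b a z| <= c_0.

Definition mean (x : 'I_N -> R) : R := N%:R^-1 * \sum_k x k.

Definition row2 k : R := mean (fun j => W k j ^+ 2).

(** The squared Hilbert-Schmidt norm of the step kernel of [W]. *)
Definition hs2 : R := mean row2.

Local Notation n := (N%:R : R).

Lemma n_gt0 : 0 < n. Proof. by rewrite ltr0n. Qed.

Lemma ler_mean x y : (forall k, x k <= y k) -> mean x <= mean y.
Proof.
by move=> xy; rewrite /mean ler_wpM2l ?invr_ge0// ler_sum.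
Qed.

Lemma mean_ge0 x : (forall k, 0 <= x k) -> 0 <= mean x.
Proof. by move=> x0; rewrite /mean mulr_ge0 ?invr_ge0// sumr_ge0. Qed.

Lemma meanD x y : mean (fun k => x k + y k) = mean x + mean y.
Proof. by rewrite /mean big_split mulrDr. Qed.

Lemma meanZ c x : mean (fun k => c * x k) = c * mean x.
Proof. by rewrite /mean -mulr_sumr mulrCA. Qed.

Lemma term_le_mean x i : (forall k, 0 <= x k) -> x i / n <= mean x.
Proof.
move=> x0; rewrite mulrC /mean ler_wpM2l ?invr_ge0// (bigD1 i)//= lerDl.
by apply: sumr_ge0.
Qed.

Lemma row2_ge0 k : 0 <= row2 k.
Proof. by apply: mean_ge0 => j; exact: sqr_ge0. Qed.

Lemma hs2_ge0 : 0 <= hs2.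
Proof. by apply: mean_ge0 => j; exact: row2_ge0. Qed.

(** An entry is at most [n] times the mean of its row, so that dividing the
    squares by [n ^ 2] leaves a factor [1 / n]; likewise on the diagonal. *)
Lemma mean_col i : mean (fun k => W k i ^+ 2 / n ^+ 2) <= hs2 / n.
Proof.
rewrite -[leRHS]mulrC -meanZ; apply: ler_mean => k.
rewrite expr2 invfM mulrA mulrC ler_wpM2l ?invr_ge0//.
exact: (@term_le_mean (fun j => W k j ^+ 2) i (fun j => sqr_ge0 _)).
Qed.

Lemma mean_diag : mean (fun k => W k k ^+ 2 / n ^+ 2) <= hs2 / n.
Proof.
rewrite -[leRHS]mulrC -meanZ; apply: ler_mean => k.
rewrite expr2 invfM mulrA mulrC ler_wpM2l ?invr_ge0//.
exact: (@term_le_mean (fun j => W k j ^+ 2) k (fun j => sqr_ge0 _)).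
Qed.

Lemma sqr_mean_le k e : (mean (fun j => W k j * e j)) ^+ 2 <=
  row2 k * mean (fun j => e j ^+ 2).
Proof.
rewrite /row2 /mean mulrACA exprMn expr2 ler_wpM2l ?mulr_ge0 ?invr_ge0//.
exact: sum_cauchy_schwarz.
Qed.

Section perturbation.
Variables (al al' : 'I_N -> R) (i : 'I_N) (zb r0 z r : 'I_N -> R).
Hypothesis alA : forall j, A (al j).
Hypothesis alA' : forall j, A (al' j).
Hypothesis al_eq : forall j, j != i -> al' j = al j.
Hypothesis zbE : forall k, zb k = mean (fun j => W k j * b (al j) (zb j)) + r0 k.
Hypothesis zE : forall k, z k = mean (fun j => W k j * b (al' j) (z j)) + r k.

Let v k := z k - zb k.

(** Changing the action of one player moves the aggregate felt by player [k]
    through the weight [W k i] alone, whose square is small on average. *)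
Lemma perturbation_pointwise k : v k ^+ 2 <=
  2 * c_z * row2 k * mean (fun j => v j ^+ 2) +
  6 * (4 * c_0 ^+ 2 * (W k i ^+ 2 / n ^+ 2) + r k ^+ 2 + r0 k ^+ 2).
Proof.
pose e j := b (al' j) (z j) - b (al' j) (zb j).
pose D := b (al' i) (zb i) - b (al i) (zb i).
have E : v k = mean (fun j => W k j * e j) + (n^-1 * (W k i * D) + r k - r0 k).
  have -> : n^-1 * (W k i * D) = mean (fun j => W k j *
      (b (al' j) (zb j) - b (al j) (zb j))).
    rewrite /mean (bigD1 i)//= big1 ?addr0// => j ji.
    by rewrite al_eq// subrr mulr0.
  rewrite /v zE zbE addrA addrA -meanD.
  have -> : mean (fun j => W k j * b (al' j) (z j)) =
    mean (fun j => W k j * e j + W k j * (b (al' j) (zb j) - b (al j) (zb j))) +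
    mean (fun j => W k j * b (al j) (zb j)).
    by rewrite -meanD; congr mean; apply/funext => j; rewrite /e; ring.
  by ring.
have D2 : D ^+ 2 <= 4 * c_0 ^+ 2.
  have : `|D| <= 2 * c_0.
    apply: (le_trans (ler_normB _ _)); rewrite mulr_natl mulr2n.
    by apply: lerD; exact: b_bounded.
  rewrite -(@ler_pXn2r _ 2)// ?nnegrE ?mulr_ge0// real_normK ?num_real//.
  by rewrite exprMn -natrX.
have m1 : mean (fun j => W k j * e j) ^+ 2 <=
    c_z * row2 k * mean (fun j => v j ^+ 2).
  apply: le_trans (sqr_mean_le _ _) _; rewrite [leRHS]mulrAC -(meanZ c_z).
  rewrite (mulrC (row2 k)) ler_wpM2r ?row2_ge0//; apply: ler_mean => j.
  exact: b_lip.
have m2 : (n^-1 * (W k i * D)) ^+ 2 <= 4 * c_0 ^+ 2 * (W k i ^+ 2 / n ^+ 2).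
  have -> : (n^-1 * (W k i * D)) ^+ 2 = D ^+ 2 * (W k i ^+ 2 / n ^+ 2).
    by field; rewrite gt_eqF// n_gt0.
  by rewrite ler_wpM2r// mulr_ge0 ?sqr_ge0// invr_ge0 exprn_ge0.
rewrite E.
set x := mean (fun j => W k j * e j) in m1 *.
set y := n^-1 * (W k i * D) in m2 *.
have h1 : 0 <= (x - (y + r k - r0 k)) ^+ 2 by exact: sqr_ge0.
have h2 : 0 <= (y - r k) ^+ 2 by exact: sqr_ge0.
have h3 : 0 <= (y + r0 k) ^+ 2 by exact: sqr_ge0.
have h4 : 0 <= (r k + r0 k) ^+ 2 by exact: sqr_ge0.
rewrite -(mulrA 2) -(mulrA 2).
set X := c_z * row2 k * _ in m1 *.
set Y := 4 * c_0 ^+ 2 * _ in m2 *.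
(* the square of a sum of two terms is at most twice, of three terms at most
   three times the sum of the squares *)
have -> : (x + (y + r k - r0 k)) ^+ 2 = 2 * (x ^+ 2) +
    2 * (3 * y ^+ 2 + 3 * r k ^+ 2 + 3 * r0 k ^+ 2 -
      (y - r k) ^+ 2 - (y + r0 k) ^+ 2 - (r k + r0 k) ^+ 2) -
    (x - (y + r k - r0 k)) ^+ 2 by ring.
lra.
Qed.

(** Averaging over the players bounds the mean square deviation by a multiple
    less than 1 of itself, which is absorbed. *)
Lemma perturbation_mean : 2 * c_z * hs2 < 1 ->
  mean (fun k => v k ^+ 2) <= 6 / (1 - 2 * c_z * hs2) *
   (4 * c_0 ^+ 2 * (hs2 / n) + mean (fun k => r k ^+ 2) +
    mean (fun k => r0 k ^+ 2)).
Proof.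
move=> small; have s0 : 0 < 1 - 2 * c_z * hs2 by rewrite subr_gt0.
have := ler_mean perturbation_pointwise.
set V := mean (fun k => v k ^+ 2).
have -> : mean (fun k => 2 * c_z * row2 k * V +
   6 * (4 * c_0 ^+ 2 * (W k i ^+ 2 / n ^+ 2) + r k ^+ 2 + r0 k ^+ 2)) =
   2 * c_z * hs2 * V + 6 * (4 * c_0 ^+ 2 * mean (fun k => W k i ^+ 2 / n ^+ 2) +
    mean (fun k => r k ^+ 2) + mean (fun k => r0 k ^+ 2)).
  rewrite meanD meanZ !meanD meanZ; congr (_ + _).
  rewrite /hs2 [RHS]mulrAC -meanZ.
  by congr mean; apply/funext => k; ring.
have mc := mean_col i.
have c2 : 0 <= 4 * c_0 ^+ 2 by rewrite mulr_ge0// sqr_ge0.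
have := ler_wpM2l c2 mc.
set X := mean (fun k => W k i ^+ 2 / n ^+ 2) => h1 h2.
rewrite [leRHS]mulrAC ler_pdivlMr//.
lra.
Qed.

End perturbation.

End finite_aggregates.

(** * Wasserstein distance to a product law *)

Section wasserstein_estimate.
Context (R : realType) (mu0 : probability R R).
Hypothesis mu0_moment2 : (\int[mu0]_x (x ^+ 2)%:E < +oo)%E.
Context d (Omega : measurableType d) (P : probability Omega R).
Variable X : {RV P >-> R}.
Hypothesis X_law : forall B, measurable B -> distribution P X B = mu0 B.
Variable Z : Omega -> R.
Hypothesis ZL : L2 P Z.

Let measurable_pair_XZ : measurable_fun setT (fun om => (X om, Z om)).
Proof.
apply: measurable_fun_pair; first exact: measurable_funP.
exact: (L2_measurable ZL).
Qed.

Definition pair_RV : {mfun Omega >-> (R * R)%type} :=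
  mfun_Sub (mem_set measurable_pair_XZ).

Definition joint_law : probability (R * R)%type R := distribution P pair_RV.

Definition product_law (c : R) : probability (R * R)%type R := (mu0 \x \d_c)%E.

Lemma joint_law_calK : calK mu0 joint_law.
Proof.
move=> B mB; rewrite -(X_law mB) /joint_law /distribution /pushforward.
by congr (P _); apply/seteqP; split => om //= [].
Qed.

Lemma joint_law_moment2 : finite_moment2 joint_law.
Proof.
have m2 : measurable_fun setT (fun p : R * R => (p.1 ^+ 2 + p.2 ^+ 2)%:E).
  by apply/measurable_EFinP; apply: measurable_funD; apply: measurable_funX.
rewrite /finite_moment2 /joint_law ge0_integral_distribution//; last first.
  by move=> y; rewrite lee_fin addr_ge0// sqr_ge0.
have XL : L2 P X.
  by apply/L2P; split; [exact: measurable_funP|rewrite (integral_sqr_law X_law)].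
under eq_integral do rewrite /= EFinD.
rewrite ge0_integralD//.
- by rewrite lte_add_pinfty//; [case/L2P: XL|case/L2P: ZL].
- by move=> om _; rewrite lee_fin sqr_ge0.
- by apply/measurable_EFinP; apply: measurable_funX; exact: measurable_funP.
- by move=> om _; rewrite lee_fin sqr_ge0.
- by apply/measurable_EFinP; apply: measurable_funX; exact: (L2_measurable ZL).
Qed.

Lemma product_law_calK c : calK mu0 (product_law c).
Proof.
move=> B mB; rewrite /product_law /= product_measure1E//.
by rewrite -[RHS]mule1; congr (_ * _)%E; exact: diracT.
Qed.

Lemma product_law_moment2 c : finite_moment2 (product_law c).
Proof.
have m2 : measurable_fun setT (fun p : R * R => (p.1 ^+ 2 + p.2 ^+ 2)%:E).
  by apply/measurable_EFinP; apply: measurable_funD; apply: measurable_funX.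
rewrite /finite_moment2 /product_law /= fubini_tonelli1//; last first.
  by move=> y; rewrite lee_fin addr_ge0// sqr_ge0.
rewrite [ltLHS](_ : _ = (\int[mu0]_x ((x ^+ 2)%:E + (c ^+ 2)%:E))%E); last first.
  apply: eq_integral => x _; rewrite /fubini_F.
  have mx : measurable_fun setT (fun y : R => (x ^+ 2 + y ^+ 2)%:E).
    by apply/measurable_EFinP; apply: measurable_funD => //; exact: measurable_funX.
  have := integral_dirac c measurableT mx.
  by rewrite diracT mul1e.
rewrite ge0_integralD//.
- rewrite lte_add_pinfty// (integral_cst mu0 measurableT (c ^+ 2)%:E).
  rewrite [X in (_ * X)%E](_ : _ = 1%E) ?mule1 ?ltry//; exact: probability_setT.
- by move=> x _; rewrite lee_fin sqr_ge0.
- by apply/measurable_EFinP; exact: measurable_funX.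
- by move=> x _; rewrite lee_fin sqr_ge0.
Qed.

Lemma product_lawE c B : measurable B ->
  product_law c B = P ((fun om => (X om, c)) @^-1` B).
Proof.
move=> mB.
have mXc : measurable_fun setT (fun om => (X om, c)).
  by apply: measurable_fun_pair => //; exact: measurable_funP.
pose Y : {mfun Omega >-> (R * R)%type} := mfun_Sub (mem_set mXc).
apply: (@product_measure_unique _ _ _ _ _ mu0 (\d_c) (distribution P Y)) => //.
move=> S T mS mT; transitivity (distribution P X S * \d_c T)%E; last first.
  by congr (_ * _)%E; exact: X_law.
rewrite /distribution /pushforward diracE.
have [cT|cT] := boolP (c \in T).
  rewrite mule1; congr (P _); apply/seteqP; split => om /=; first by case.
  by move=> ?; split => //; rewrite inE in cT.
rewrite mule0 /= -[RHS](measure0 P); congr (P _).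
by apply/seteqP; split => om //= [_ /mem_set h]; rewrite h in cT.
Qed.

(** The coupling of [(X, Z)] and [(X, c)] on the same space moves the second
    coordinate only. *)
Lemma W2_joint_product c B : 0 <= B ->
  (\int[P]_om ((Z om - c) ^+ 2)%:E <= B%:E)%E ->
  (W2 joint_law (product_law c) <= (Num.sqrt B)%:E)%E.
Proof.
move=> B0 ZB.
have mq : measurable_fun setT (fun om => ((X om, Z om), (X om, c))).
  apply: (measurable_fun_pair measurable_pair_XZ).
  by apply: measurable_fun_pair; [exact: measurable_funP|exact: measurable_cst].
pose Q : {mfun Omega >-> ((R * R) * (R * R))%type} := mfun_Sub (mem_set mq).
rewrite /W2 -[(Num.sqrt B)%:E]/(sqrte B%:E) lee_sqrt ?lee_fin//.
apply: ereal_inf_le; exists (\int[P]_om ((Z om - c) ^+ 2)%:E)%E => //.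
exists (distribution P Q).
  split=> S mS; rewrite /distribution /pushforward.
    by congr (P _); apply/seteqP; split => om //= [].
  rewrite product_lawE//.
  by congr (P _); apply/seteqP; split => om //= [].
have m2 : measurable_fun setT (fun q : (R * R) * (R * R) =>
    ((q.1.1 - q.2.1) ^+ 2 + (q.1.2 - q.2.2) ^+ 2)%:E).
  apply/measurable_EFinP; apply: measurable_funD; apply: measurable_funX;
    by apply: measurable_funB; do 2!apply: measurableT_comp => //.
rewrite ge0_integral_distribution//; last first.
  by move=> q; rewrite lee_fin addr_ge0// sqr_ge0.
by apply: eq_integral => om _ /=; rewrite subrr expr0n add0r.
Qed.

Variables (A : set R) (b : R -> R -> R) (f : R -> R -> R -> R) (ell_Jt : R).
Hypothesis ell_Jt0 : 0 <= ell_Jt.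
Hypothesis hJt_lip : forall (a : R) (nu nu' : probability (R * R)%type R), A a ->
     calK mu0 nu -> finite_moment2 nu -> calK mu0 nu' -> finite_moment2 nu' ->
     (`|Jtilde b f a nu' - Jtilde b f a nu|%:E <= ell_Jt%:E * W2 nu nu')%E.

Lemma Jtilde_joint_approx a c B : A a -> 0 <= B ->
  (\int[P]_om ((Z om - c) ^+ 2)%:E <= B%:E)%E ->
  `|J mu0 b f a c - Jtilde b f a (pushforward P (fun om => (X om, Z om)))| <=
  ell_Jt * Num.sqrt B.
Proof.
move=> Aa B0 ZB; rewrite -lee_fin EFinM.
have h := hJt_lip Aa joint_law_calK joint_law_moment2 (product_law_calK c)
  (product_law_moment2 c).
apply: le_trans h _.
by apply: lee_wpmul2l; [rewrite lee_fin|exact: W2_joint_product].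
Qed.

End wasserstein_estimate.

(** * Nash equilibria of the finite game *)

Section approximate_nash.
Context (R : realType) (mu0 : probability R R).
Hypothesis mu0_int : mu0.-integrable setT (fun x : R => x%:E).
Hypothesis mu0_mean : (\int[mu0]_x x%:E = 0)%E.
Hypothesis mu0_moment2 : (\int[mu0]_x (x ^+ 2)%:E < +oo)%E.
Variables (A : set R) (b : R -> R -> R) (f : R -> R -> R -> R).
Variables (c_z c_0 ell_Jt : R).
Hypothesis c_z0 : 0 <= c_z.
Hypothesis c_00 : 0 <= c_0.
Hypothesis b_lip : forall a z z', A a ->
  (b a z - b a z') ^+ 2 <= c_z * (z - z') ^+ 2.
Hypothesis b_bounded : forall a z, A a -> `|b a z| <= c_0.
Hypothesis ell_Jt0 : 0 <= ell_Jt.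
Hypothesis hJt_lip : forall (a : R) (nu nu' : probability (R * R)%type R), A a ->
     calK mu0 nu -> finite_moment2 nu -> calK mu0 nu' -> finite_moment2 nu' ->
     (`|Jtilde b f a nu' - Jtilde b f a nu|%:E <= ell_Jt%:E * W2 nu nu')%E.
Context d (Omega : measurableType d) (P : probability Omega R) (N : nat).
Hypothesis N0 : (0 < N)%N.
Variables (W : 'M[R]_N) (xi : 'I_N -> {RV P >-> R}).
Hypothesis xi_iid : iid_law mu0 xi.
Hypothesis game_well_posed : well_posed A b W xi.
Variable al : 'I_N -> R.
Hypothesis al_nash : is_nash A b f W xi al.
Hypothesis small : 2 * c_z * hs2 W < 1.

Local Notation n := (N%:R : R).
Local Notation s2 := (second_moment mu0).

Let noise k om := mean (fun j => W k j * xi j om).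

Let aggregateP a : (forall i, A (a i)) ->
  is_aggregate b W xi a (aggregate b W xi a).
Proof.
move=> aA; have [z [zP _]] := game_well_posed aA.
by apply: xgetPex; exists z.
Qed.

Let L2_noise k : L2 P (noise k).
Proof.
by apply: L2Z; apply: L2_sum => j; apply: L2Z; exact: (L2_xi mu0_moment2 xi_iid).
Qed.

Let Rintegral_sqr_noise k : \int[P]_om (noise k om ^+ 2) = s2 * (row2 W k / n).
Proof.
have -> : noise k = (fun om => \sum_j (n^-1 * W k j) * xi j om).
  apply/funext => om; rewrite /noise /mean mulr_sumr.
  by apply: eq_bigr => j _; rewrite mulrA.
rewrite /Rintegral (integral_sqr_noise mu0_int mu0_mean mu0_moment2 xi_iid)/=.
congr (_ * _).
rewrite /row2 /mean mulrAC -mulrA mulr_sumr mulr_sumr.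
by apply: eq_bigr => j _; ring.
Qed.

Let Rintegral_mean (g : 'I_N -> Omega -> R) :
  (forall k, P.-integrable setT (EFin \o g k)) ->
  P.-integrable setT (EFin \o (fun om => mean (fun k => g k om))) /\
  \int[P]_om mean (fun k => g k om) = mean (fun k => \int[P]_om g k om).
Proof.
move=> ig; have [i1 i2] := Rintegral_sum (index_enum 'I_N) ig.
split; first exact: (integrableZl measurableT n^-1 i1).
by rewrite /mean RintegralZl// i2.
Qed.

Let mean_noise2 om := mean (fun k => noise k om ^+ 2).

Let mean_noise2_int : P.-integrable setT (EFin \o mean_noise2) /\
  \int[P]_om mean_noise2 om = s2 * (hs2 W / n).
Proof.
have [i1 i2] := Rintegral_mean (fun k => L2_integrable_sqr (L2_noise k)).
split => //; rewrite [LHS]i2.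
rewrite (_ : (fun k => _) = (fun k => s2 / n * row2 W k)).
  by rewrite meanZ /hs2; ring.
by apply/funext => k; rewrite Rintegral_sqr_noise; ring.
Qed.

(** A sample point at which the aggregate solves its system and the noise is no
    larger than on average: freezing it there replaces the random aggregate by
    a deterministic one, up to a small error. *)
Let exists_sample (z : 'I_N -> Omega -> R) : is_aggregate b W xi al z ->
  exists om, (forall k, z k om = mean (fun j => W k j * b (al j) (z j om)) + noise k om)
    /\ mean_noise2 om <= (s2 * hs2 W + 1) / n.
Proof.
move=> [_ zE]; have [i1 i2] := mean_noise2_int.
set c := (s2 * hs2 W + 1) / n.
have n0 : 0 < n by rewrite ltr0n.
apply: contrapT => H.
have ae_lt : {ae P, forall om, (c%:E <= (mean_noise2 om)%:E)%E}.
  apply: filterS zE => om zom; rewrite lee_fin leNgt; apply/negP => lt.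
  apply: H; exists om; split; last exact: ltW.
  move=> k; rewrite {1}zom /noise -meanD /mean; congr (_ * _).
  by apply: eq_bigr => j _; rewrite mulrDr.
have : (c%:E <= \int[P]_om (mean_noise2 om)%:E)%E.
  have -> : c%:E = (\int[P]_om (cst c%:E) om)%E.
    rewrite integral_cst// [X in (_ * X)%E](_ : _ = 1%E) ?mule1//.
    exact: probability_setT.
  have c0 : 0 <= c.
    apply: divr_ge0; last exact: ltW.
    by rewrite addr_ge0// mulr_ge0 ?second_moment_ge0// hs2_ge0.
  have mcst : measurable_fun setT (cst c%:E : Omega -> \bar R).
    exact: measurable_cst.
  apply: (ae_ge0_le_integral measurableT _ mcst _ (measurable_int P i1) _).
  - by move=> om _ /=; rewrite lee_fin.
  - by move=> om _; rewrite lee_fin; apply: mean_ge0 => k; exact: sqr_ge0.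
  - by apply: filterS ae_lt.
rewrite -(fineK (integrable_fin_num measurableT i1)) lee_fin.
rewrite [X in _ <= X]i2 /c mulrA ler_pdivrMr// mulfVK ?gt_eqF//.
by rewrite gerDl ler10.
Qed.

Section error_bound.
Variables zb r0 : 'I_N -> R.
Hypothesis zbE : forall k, zb k = mean (fun j => W k j * b (al j) (zb j)) + r0 k.

(** The expectation of the pointwise perturbation bound, with the bound on the
    mean square deviation inserted; it is the same for all deviations of player
    [i]. *)
Definition deviation_bound (i : 'I_N) : R :=
  2 * c_z * row2 W i * (6 / (1 - 2 * c_z * hs2 W) *
    (4 * c_0 ^+ 2 * (hs2 W / n) + s2 * (hs2 W / n) + mean (fun k => r0 k ^+ 2))) +
  6 * (4 * c_0 ^+ 2 * (W i i ^+ 2 / n ^+ 2) + s2 * (row2 W i / n) + r0 i ^+ 2).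

Lemma deviation_bound_ge0 i : 0 <= deviation_bound i.
Proof.
have s0 : 0 < 1 - 2 * c_z * hs2 W by rewrite subr_gt0.
have m0 : 0 <= mean (fun k => r0 k ^+ 2) by apply: mean_ge0 => k; exact: sqr_ge0.
have h0 := hs2_ge0 W; have w0 := row2_ge0 W i.
have ss0 := second_moment_ge0 mu0; have n0 : 0 <= n by rewrite ler0n.
rewrite /deviation_bound; repeat first
  [done | exact: (ltW s0) | exact: sqr_ge0 | rewrite invr_ge0
  | apply: addr_ge0 | apply: mulr_ge0].
Qed.

Lemma mean_deviation_bound : mean (fun k => r0 k ^+ 2) <= (s2 * hs2 W + 1) / n ->
  mean deviation_bound <= (12 * c_z * hs2 W / (1 - 2 * c_z * hs2 W) + 6) *
    (4 * c_0 ^+ 2 * hs2 W + 2 * s2 * hs2 W + 1) / n.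
Proof.
move=> r0le; have s0 : 0 < 1 - 2 * c_z * hs2 W by rewrite subr_gt0.
set q := 4 * c_0 ^+ 2 * (hs2 W / n) + s2 * (hs2 W / n) + mean (fun k => r0 k ^+ 2).
set g := 6 / (1 - 2 * c_z * hs2 W).
have -> : mean deviation_bound = 2 * c_z * g * q * hs2 W +
    6 * (4 * c_0 ^+ 2 * mean (fun k => W k k ^+ 2 / n ^+ 2) + s2 * (hs2 W / n) +
    mean (fun k => r0 k ^+ 2)).
  rewrite /deviation_bound -/q -/g meanD meanZ !meanD meanZ; congr (_ + 6 * (_ + _ + _)).
    by rewrite /hs2 -meanZ; congr mean; apply/funext => k; ring.
  by rewrite /hs2 mulrA mulrAC -meanZ; congr mean; apply/funext => k; ring.
have md := mean_diag W.
have c2 : 0 <= 4 * c_0 ^+ 2 by rewrite mulr_ge0// sqr_ge0.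
have h0 := hs2_ge0 W.
have g0 : 0 <= g by rewrite /g divr_ge0// ltW.
have q1 : q <= (4 * c_0 ^+ 2 * hs2 W + 2 * s2 * hs2 W + 1) / n.
  by rewrite /q; move: r0le; rewrite !mulrDl mul1r !mulrA; lra.
set Q := (4 * c_0 ^+ 2 * hs2 W + 2 * s2 * hs2 W + 1) / n in q1.
have -> : (12 * c_z * hs2 W / (1 - 2 * c_z * hs2 W) + 6) *
    (4 * c_0 ^+ 2 * hs2 W + 2 * s2 * hs2 W + 1) / n =
    2 * c_z * g * hs2 W * Q + 6 * Q.
  by rewrite /Q /g; field; rewrite !gt_eqF// ltr0n.
apply: lerD.
  rewrite mulrAC ler_wpM2l// mulr_ge0// mulr_ge0// mulr_ge0//.
rewrite ler_wpM2l//; apply: le_trans q1; rewrite /q lerD2r lerD2r.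
by rewrite ler_wpM2l.
Qed.

Lemma deviation_estimate i beta : A beta ->
  L2 P (aggregate b W xi (deviate i beta al) i) /\
  (\int[P]_om ((aggregate b W xi (deviate i beta al) i om - zb i) ^+ 2)%:E <=
    (deviation_bound i)%:E)%E.
Proof.
move=> Abeta; have [alA _] := al_nash.
have alA' j : A (deviate i beta al j) by rewrite /deviate; case: ifP.
set z := aggregate _ _ _ _; have [zL zE] := aggregateP alA'.
rewrite -/z in zL zE; split => //.
pose g := 6 / (1 - 2 * c_z * hs2 W).
pose C1 := 2 * c_z * row2 W i * g.
pose C2 := 4 * c_0 ^+ 2 * (hs2 W / n) + mean (fun k => r0 k ^+ 2).
pose C3 := 4 * c_0 ^+ 2 * (W i i ^+ 2 / n ^+ 2) + r0 i ^+ 2.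
pose H om := C1 * mean_noise2 om + (6 * noise i om ^+ 2 + (C1 * C2 + 6 * C3)).
have s0 : 0 < 1 - 2 * c_z * hs2 W by rewrite subr_gt0.
have C10 : 0 <= C1.
  have w0 := row2_ge0 W i.
  by rewrite /C1 /g; repeat first
    [done | exact: (ltW s0) | rewrite invr_ge0 | apply: mulr_ge0].
have [i1 i2] := mean_noise2_int.
have in1 := integrableZl measurableT C1 i1.
have in2 := integrableZl measurableT 6 (L2_integrable_sqr (L2_noise i)).
have in3 : P.-integrable setT (EFin \o cst (C1 * C2 + 6 * C3)).
  exact: finite_measure_integrable_cst.
have in23 := integrableD measurableT in2 in3.
have iH : P.-integrable setT (EFin \o H) by exact: (integrableD measurableT in1 in23).
have EH : (\int[P]_om (H om)%:E = (deviation_bound i)%:E)%E.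
  rewrite -(fineK (integrable_fin_num measurableT iH)); congr EFin.
  rewrite -/(Rintegral P setT H) /H RintegralD// RintegralD// RintegralZl// i2.
  rewrite RintegralZl//; last exact: L2_integrable_sqr.
  rewrite Rintegral_sqr_noise Rintegral_cst//.
  rewrite [X in fine X](_ : _ = 1%E); last exact: probability_setT.
  by rewrite /deviation_bound /= -/g /C1 /C2 /C3; ring.
rewrite -EH; apply: ae_ge0_le_integral => //.
- by move=> om _; rewrite lee_fin sqr_ge0.
- apply/measurable_EFinP; apply: measurable_funX; apply: measurable_funB => //.
  exact: (L2_measurable (zL i)).
- move=> om _; rewrite lee_fin /H; apply: addr_ge0.
    by rewrite mulr_ge0//; apply: mean_ge0 => k; exact: sqr_ge0.
  apply: addr_ge0; first by rewrite mulr_ge0// sqr_ge0.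
  have n0 : 0 <= n by rewrite ler0n.
  have m0 : 0 <= mean (fun k => r0 k ^+ 2) by apply: mean_ge0 => k; exact: sqr_ge0.
  have h0 := hs2_ge0 W.
  by rewrite /C2 /C3; repeat first
    [done | exact: sqr_ge0 | rewrite invr_ge0 | apply: addr_ge0 | apply: mulr_ge0].
- exact: (measurable_int P iH).
- apply: filterS zE => om zom _; rewrite lee_fin.
  have zE' k : z k om = mean (fun j => W k j * b (deviate i beta al j) (z j om)) +
      noise k om.
    rewrite {1}zom /noise -meanD /mean; congr (_ * _).
    by apply: eq_bigr => j _; rewrite mulrDr.
  have al_eq j : j != i -> deviate i beta al j = al j.
    by rewrite /deviate => /negbTE ->.
  have pp := perturbation_pointwise N0 c_00 b_lip b_bounded alA alA' al_eq zbE zE' i.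
  have pm := perturbation_mean N0 c_00 b_lip b_bounded alA alA' al_eq zbE zE' small.
  apply: (le_trans pp); rewrite /H.
  have c10 : 0 <= 2 * c_z * row2 W i.
    by apply: mulr_ge0; [exact: mulr_ge0|exact: row2_ge0].
  have := ler_wpM2l c10 pm; rewrite -/(mean_noise2 om) -/g /C1 /C2 /C3.
  lra.
Qed.

(** Both sides of the Nash inequality are compared with the cost at the law
    in which the aggregate is frozen at [zb i]; keeping the action of player [i]
    is the particular deviation to [al i]. *)
Lemma nash_approx i beta : A beta ->
  J mu0 b f (al i) (zb i) <=
  J mu0 b f beta (zb i) + 2 * ell_Jt * Num.sqrt (deviation_bound i).
Proof.
move=> Abeta; have [alA nash] := al_nash.
have B0 := deviation_bound_ge0 i.
have dal : deviate i (al i) al = al.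
  by apply/funext => j; rewrite /deviate; case: eqVneq => [->|].
have law k := xi_iid.1 k.
have [zL0 e0] := deviation_estimate i (alA i); rewrite dal in zL0 e0.
have [zL1 e1] := deviation_estimate i Abeta.
have h0 := Jtilde_joint_approx mu0_moment2 (law i) zL0 ell_Jt0 hJt_lip (alA i) B0 e0.
have h1 := Jtilde_joint_approx mu0_moment2 (law i) zL1 ell_Jt0 hJt_lip Abeta B0 e1.
have := nash i beta Abeta; rewrite /player_cost.
have -> : deviate i beta al i = beta by rewrite /deviate eqxx.
move: h0 h1.
set x0 := Jtilde b f (al i) _; set x1 := Jtilde b f beta _.
rewrite !ler_norml => /andP[? ?] /andP[? ?] ?; lra.
Qed.

End error_bound.

(** A Nash equilibrium of the game with [N] players is an approximate
    equilibrium of a deterministic game: the squares of the errors in the costs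
    are of order [1 / N] on average over the players. *)
Lemma finite_nash_approx : exists zb r0 B : 'I_N -> R,
  [/\ forall k, zb k = mean (fun j => W k j * b (al j) (zb j)) + r0 k,
      mean (fun k => r0 k ^+ 2) <= (s2 * hs2 W + 1) / n,
      forall k, 0 <= B k,
      mean B <= (12 * c_z * hs2 W / (1 - 2 * c_z * hs2 W) + 6) *
        (4 * c_0 ^+ 2 * hs2 W + 2 * s2 * hs2 W + 1) / n &
      forall i beta, A beta -> J mu0 b f (al i) (zb i) <=
        J mu0 b f beta (zb i) + 2 * ell_Jt * Num.sqrt (B i)].
Proof.
have [om [zom r0le]] := exists_sample (aggregateP al_nash.1).
exists (fun k => aggregate b W xi al k om), (fun k => noise k om),
  (deviation_bound (fun k => noise k om)); split => //.
- by move=> k; exact: deviation_bound_ge0.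
- exact: mean_deviation_bound.
- by move=> i beta; exact: (nash_approx zom).
Qed.

End approximate_nash.

(** * Step functions *)

Section step_functions.
Variables (R : realType) (N : nat).
Implicit Types (h : 'I_N -> R) (W : 'M[R]_N).

Lemma measurable_cell (i : 'I_N) : measurable (cell i : set R).
Proof. exact: measurable_itv. Qed.

(** The last point of the interval lies in no cell, whence the strict bound. *)
Lemma step1_eval x : (0 < N)%N -> 0 <= x -> x < 1 ->
  exists i, forall h, step1 h x = h i.
Proof.
move=> N0 x0 x1; have n0 : 0 < N%:R :> R by rewrite ltr0n.
have tE : Num.truncn (x * N%:R) = Num.truncn (x * N%:R) by [].
have /andP[t1 t2] := truncn_itv (mulr_ge0 x0 (ltW n0)).
set t := Num.truncn (x * N%:R) in t1 t2.
have tN : (t < N)%N.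
  rewrite -(ltr_nat R); apply: le_lt_trans t1 _.
  by rewrite -[ltRHS]mul1r ltr_pM2r.
exists (Ordinal tN) => h; rewrite /step1 (bigD1 (Ordinal tN))//= big1 ?addr0.
  rewrite indicE mem_set ?mulr1// /cell /= in_itv /=.
  by rewrite ler_pdivrMr// ltr_pdivlMr// t1 t2.
move=> j jt; rewrite indicE memNset ?mulr0// /cell /= in_itv /=.
rewrite ler_pdivrMr// ltr_pdivlMr// => /andP[j1 j2].
move/eqP : jt; apply; apply/val_inj => /=; apply/eqP.
rewrite eqn_leq -ltnS -(ltnS t) -!(ltr_nat R).
by rewrite (le_lt_trans j1 t2) (le_lt_trans t1 j2).
Qed.

Lemma step2E W x y : step2 W (x, y) = step1 (fun i => step1 (W i) y) x.
Proof.
rewrite /step2 /step1 /=; apply: eq_bigr => i _; rewrite mulr_suml.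
by apply: eq_bigr => j _; rewrite mulrAC.
Qed.

Lemma L2_step1 h : L2 muI (step1 h).
Proof.
apply: L2_sum => i; apply: L2Z.
by apply: L2_indic; exact: measurable_cell.
Qed.

Lemma L2_step2 W : L2 (muI \x muI)%E (step2 W).
Proof.
apply: L2_sum => i; apply: L2_sum => j.
have -> : (fun p : R * R => W i j * \1_(cell i) p.1 * \1_(cell j) p.2) =
    (fun p => W i j * \1_(cell i `*` cell j) p).
  apply/funext => -[x y]; rewrite !indicE -mulrA; congr (_ * _).
  by rewrite in_setX /=; case: (x \in _); case: (y \in _); rewrite ?mulr1 ?mulr0.
by apply: L2Z; apply: L2_indic; apply: measurableX; exact: measurable_cell.
Qed.

Lemma muI_cell (i : 'I_N) : (0 < N)%N -> muI (cell i : set R) = (N%:R^-1)%:E.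
Proof.
move=> N0; have n0 : 0 < N%:R :> R by rewrite ltr0n.
rewrite muIE (_ : _ `&` _ = cell i); last first.
  apply/setIidPl => x; rewrite /cell /I01 /= !in_itv/= => /andP[h1 h2].
  rewrite (le_trans _ h1) ?divr_ge0//= (ltW (lt_le_trans h2 _))//.
  by rewrite ler_pdivrMr// mul1r ler_nat.
rewrite /cell lebesgue_measure_itv/= lte_fin ltr_pM2r ?invr_gt0// ltr_nat ltnSn.
by rewrite -EFinB -mulrBl -natr1 addrAC subrr add0r mul1r.
Qed.

Lemma Rintegral_step1 h : (0 < N)%N -> \int[muI]_x step1 h x = mean h.
Proof.
move=> N0.
have i1 i : muI.-integrable setT (EFin \o (fun x : R => h i * \1_(cell i) x)).
  by apply: L2_integrable; apply: L2Z; apply: L2_indic; exact: measurable_cell.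
rewrite (Rintegral_sum _ i1).2 /mean mulr_sumr; apply: eq_bigr => i _.
rewrite RintegralZl//; last first.
  by apply: L2_integrable; apply: L2_indic; exact: measurable_cell.
rewrite mulrC; congr (_ * _).
rewrite /Rintegral integral_indic//; last exact: measurable_cell.
by rewrite setIT [X in fine X](muI_cell _ N0).
Qed.

Variable phi : R -> R.
Hypothesis mphi : measurable_fun setT phi.
Hypothesis phi_mp : forall S, measurable S -> muI (phi @^-1` S) = muI S.
Hypothesis N0 : (0 < N)%N.

Lemma step1_ae : {ae muI, forall x, exists i, forall h, step1 h (phi x) = h i}.
Proof.
apply: (ae_mp mphi phi_mp (P := fun x => exists i, forall h, step1 h x = h i)).
by apply: muI_ae_lt1 => x x0 x1; exact: step1_eval.
Qed.

Lemma L2_step1_mp h : L2 muI (fun x => step1 h (phi x)).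
Proof. exact: (L2_mp mphi phi_mp (L2_step1 h)).1. Qed.

Lemma L2_step2_mp W : L2 (muI \x muI)%E (fun p => step2 W (phi p.1, phi p.2)).
Proof. exact: (L2_mp2 mphi phi_mp (L2_step2 W)).1. Qed.

Lemma Rintegral_step1_mp h (g : R -> R) : measurable_fun setT g ->
  {ae muI, forall x, g x = step1 h (phi x)} -> \int[muI]_x g x = mean h.
Proof.
move=> mg gh; rewrite -Rintegral_step1// -(Rintegral_mp mphi phi_mp (L2_step1 h)).
rewrite /Rintegral; congr fine; apply: ae_eq_integral => //.
- exact/measurable_EFinP.
- by apply/measurable_EFinP; exact: (L2_measurable (L2_step1_mp h)).
- by apply: filterS gh => x -> _.
Qed.

Lemma norm2_step1_mp h :
  norm2 muI (fun x => step1 h (phi x)) ^+ 2 = mean (fun i => h i ^+ 2).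
Proof.
rewrite norm2_sqrR; last exact: L2_step1_mp.
apply: Rintegral_step1_mp.
  by apply: measurable_funX; exact: (L2_measurable (L2_step1_mp h)).
by apply: filterS step1_ae => x [i E]; rewrite !E.
Qed.

(** On a relabelled step function, a relabelled step kernel acts as the matrix
    with weight [1 / N], because [phi] preserves the measure of the cells. *)
Lemma kernel_op_step2_mp W h (g : R -> R) : measurable_fun setT g ->
  {ae muI, forall y, g y = step1 h (phi y)} ->
  {ae muI, forall x,
    kernel_op muI (fun p => step2 W (phi p.1, phi p.2)) g x =
    step1 (fun i => mean (fun j => W i j * h j)) (phi x)}.
Proof.
move=> mg gh; apply: filterS step1_ae => x [i Ei].
rewrite Ei /kernel_op; apply: Rintegral_step1_mp.
  apply: measurable_funM => //.
  exact: (measurable_fun_pair2 x (L2_measurable (L2_step2_mp W))).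
apply: filterS2 step1_ae gh => y [j Ej] ->.
by rewrite /= step2E Ei !Ej.
Qed.

End step_functions.

Lemma norm2_step2 (R : realType) (N : nat) (W : 'M[R]_N) : (0 < N)%N ->
  graphon_norm2 (step2 W) ^+ 2 = hs2 W.
Proof.
move=> N0; rewrite /graphon_norm2 norm2_sqrR; last exact: L2_step2.
rewrite -[hs2 W]/(mean (row2 W)) -(Rintegral_step1 _ N0) /Rintegral; congr fine.
rewrite integral_sqr_rows; last exact: (L2_measurable (L2_step2 W)).
have id_mp S : measurable S -> muI (idfun @^-1` S) = muI S :> \bar R by [].
have mid : measurable_fun setT (@idfun R) by exact: measurable_id.
apply: ae_eq_integral => //.
- by apply: measurable_sqr_row; exact: (L2_measurable (L2_step2 W)).
- by apply/measurable_EFinP; exact: (L2_measurable (L2_step1 _)).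
- apply: filterS (step1_ae mid id_mp N0) => x [i Ei] _.
  have wL : L2 muI (fun y => step2 W (x, y)).
    rewrite (_ : (fun y => _) = step1 (W i)); first exact: L2_step1.
    by apply/funext => y; rewrite step2E -[x]/(idfun x) Ei.
  rewrite -norm2_sqr// norm2_sqrR//; congr EFin.
  rewrite -[x in RHS]/(idfun x) Ei.
  apply: (Rintegral_step1_mp mid id_mp N0).
    by apply: measurable_funX; exact: (L2_measurable wL).
  apply: filterS (step1_ae mid id_mp N0) => y [j Ej].
  by rewrite step2E -[x]/(idfun x) Ei -[y]/(idfun y) !Ej.
Qed.

(** * Stability of equilibria of the graphon game *)

Lemma ler_sqr_sqrtrD (R : rcfType) (p q x y : R) : 0 <= p -> 0 <= q ->
  0 <= x -> 0 <= y ->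
  p * x ^+ 2 + q * y ^+ 2 <= (Num.sqrt p * x + Num.sqrt q * y) ^+ 2.
Proof.
move=> p0 q0 x0 y0; have sp := sqr_sqrtr p0; have sq := sqr_sqrtr q0.
have s0 := sqrtr_ge0 p; have t0 := sqrtr_ge0 q.
move: sp sq s0 t0; move: (Num.sqrt p) (Num.sqrt q) => s t <- <- s0 t0.
have : 0 <= 2 * ((s * x) * (t * y)) by rewrite !mulr_ge0.
lra.
Qed.

Lemma ae_le_Rintegral d (T : measurableType d) (R : realType)
    (mu : {measure set T -> \bar R}) (f g : T -> R) :
  mu.-integrable setT (EFin \o f) -> mu.-integrable setT (EFin \o g) ->
  {ae mu, forall x, f x <= g x} -> \int[mu]_x f x <= \int[mu]_x g x.
Proof.
move=> fi gi fg; rewrite -subr_ge0 -RintegralB//.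
have igf := integrableB measurableT gi fi.
rewrite [X in 0 <= X](_ : _ = \int[mu]_x `|g x - f x|).
  by apply: Rintegral_ge0 => x _.
have mgf := measurable_int mu igf.
rewrite /Rintegral; congr fine; apply: ae_eq_integral => //.
- by apply/measurable_EFinP; apply: measurableT_comp => //; apply/measurable_EFinP.
- by apply: filterS fg => x h _; rewrite ger0_norm// subr_ge0.
Qed.

(** If [D] were at least [e], each term on the right would be at most a quarter
    of [g * D ^ 2]. *)
Lemma quadratic_small (R : realFieldType) (g p q e D : R) : 0 < g -> 0 < e ->
  g * D ^+ 2 <= p * D + q -> p <= g * (e / 4) -> q <= g * (e ^+ 2 / 4) ->
  0 <= D -> D < e.
Proof.
move=> g0 e0 H pe qe D0; rewrite ltNge; apply/negP => eD.
have Dp : 0 < D by exact: lt_le_trans eD.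
have h1 : p * D <= g * (e / 4) * D by rewrite ler_wpM2r.
have h2 : g * (e / 4) * D <= g * (D ^+ 2 / 4).
  by rewrite -mulrA ler_wpM2l ?(ltW g0)// expr2; nra.
have h3 : g * (e ^+ 2 / 4) <= g * (D ^+ 2 / 4).
  rewrite ler_wpM2l ?(ltW g0)// ler_wpM2r// ler_pXn2r// nnegrE ltW//.
have h4 : 0 < g * D ^+ 2 by rewrite mulr_gt0// exprn_gt0.
lra.
Qed.

Section stability.
Variables (R : realType) (A : set R) (J dJ : R -> R -> R) (b : R -> R -> R).
Variables (c_alpha c_z c_0 ell_c ell_J : R).
Hypothesis Acv : convex_set (A : set R^o).
Hypotheses (c_alpha0 : 0 <= c_alpha) (c_z0 : 0 <= c_z) (c_00 : 0 <= c_0).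
Hypothesis ell_J0 : 0 <= ell_J.
Hypothesis b_lip : forall a a' z z', `|b a z - b a' z'| ^+ 2 <=
  c_alpha * `|a - a'| ^+ 2 + c_z * `|z - z'| ^+ 2.
Hypothesis b_bounded : forall a z, `|b a z| <= c_0.
Hypothesis J_derive : forall a z, A a -> is_derive_within A (J ^~ z) a (dJ a z).
Hypothesis J_convex : forall a a' z eps, A a -> A a' -> 0 <= eps -> eps <= 1 ->
  J (eps * a + (1 - eps) * a') z <= eps * J a z + (1 - eps) * J a' z
    - ell_c / 2 * eps * (1 - eps) * `|a - a'| ^+ 2.
Hypothesis dJ_lip : forall a z z', A a -> `|dJ a z' - dJ a z| <= ell_J * `|z' - z|.
Variables (w w' : R * R -> R) (a z a' z' r eps : R -> R).
Hypotheses (wL : L2 (muI \x muI)%E w) (wL' : L2 (muI \x muI)%E w').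
Hypotheses (aL : L2 muI a) (zL : L2 muI z) (aL' : L2 muI a') (zL' : L2 muI z').
Hypotheses (rL : L2 muI r) (epsL : L2 muI eps).
Hypothesis zE : {ae muI, forall x, z x = kernel_op muI w (fun y => b (a y) (z y)) x}.
Hypothesis zE' : {ae muI, forall x,
  z' x = kernel_op muI w' (fun y => b (a' y) (z' y)) x + r x}.

Local Notation L := (graphon_opnorm w).
Local Notation D := (norm2 muI (fun x => a' x - a x)).
Local Notation Z := (norm2 muI (fun x => z' x - z x)).

Let mb (u v : R -> R) : measurable_fun setT u -> measurable_fun setT v ->
  measurable_fun setT (fun y => b (u y) (v y)).
Proof. exact: (measurable_fun_lipschitz2 c_alpha0 c_z0 b_lip). Qed.

Let L2_b (u v : R -> R) : L2 muI u -> L2 muI v -> L2 muI (fun y => b (u y) (v y)).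
Proof.
move=> uL vL; apply: (L2_bounded (c := c_0)); last by apply: aeW.
by apply: mb; [exact: L2_measurable uL|exact: L2_measurable vL].
Qed.

(** The difference of the aggregates splits into the difference of the kernels
    applied to a bounded function, the operator of [w] applied to the difference
    of the drifts, and the residue [r]. *)
Lemma aggregate_stability : Z <= c_0 * norm2 (muI \x muI)%E (fun p => w' p - w p) +
  L * (Num.sqrt c_alpha * D + Num.sqrt c_z * Z) + norm2 muI r.
Proof.
pose g' y := b (a' y) (z' y); pose g y := b (a y) (z y).
have gL' : L2 muI g' by exact: L2_b.
have gL : L2 muI g by exact: L2_b.
have dwL : L2 (muI \x muI)%E (fun p => w' p - w p) by exact: L2B.
have dgL : L2 muI (fun y => g' y - g y) by exact: L2B.
pose K1 := kernel_op muI (fun p => w' p - w p) g'.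
pose K2 := kernel_op muI w (fun y => g' y - g y).
have K1L : L2 muI K1 by exact: L2_kernel_op.
have K2L : L2 muI K2 by exact: L2_kernel_op.
rewrite [leLHS](_ : _ = norm2 muI (fun x => (K1 x + K2 x) + r x)); last first.
  apply: norm2_ae_eq.
  - by apply: measurable_funB; [exact: L2_measurable zL'|exact: L2_measurable zL].
  - by apply: L2D => //; exact: L2D.
  - apply: filterS3 zE zE' (filterI (ae_L2_row wL) (ae_L2_row wL')).
    move=> x -> -> [wxL wxL'].
    rewrite addrAC; congr (_ + _); rewrite /K1 /K2 /kernel_op.
    rewrite -RintegralD//; last 2 first.
    + by apply: L2_integrable_mul => //; exact: L2B.
    + exact: L2_integrable_mul.
    rewrite -RintegralB//; [|exact: L2_integrable_mul..].
    by apply: eq_Rintegral => y _; rewrite /g' /g; ring.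
apply: le_trans (norm2_triangle (L2D K1L K2L) rL) _; rewrite lerD2r.
apply: le_trans (norm2_triangle K1L K2L) _; apply: lerD.
  apply: le_trans (norm2_kernel_op dwL gL') _.
  rewrite mulrC ler_wpM2r ?norm2_ge0// -[leRHS]ger0_norm//.
  apply: norm2_bounded; first exact: L2_measurable gL'.
  by apply: aeW => y; exact: b_bounded.
apply: le_trans (norm2_graphon_op wL dgL) _.
rewrite ler_wpM2l ?graphon_opnorm_ge0//.
have dal : L2 muI (fun x => a' x - a x) by exact: L2B.
have dzl : L2 muI (fun x => z' x - z x) by exact: L2B.
apply: norm2_le_sqr => //.
  by rewrite addr_ge0// mulr_ge0 ?sqrtr_ge0 ?norm2_ge0.
apply: (@le_trans _ _ (\int[muI]_x (c_alpha * (a' x - a x) ^+ 2 +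
    c_z * (z' x - z x) ^+ 2)%:E)%E).
  apply: ae_le_integral_sqr.
  - exact: L2_measurable dgL.
  - by apply: measurable_funD; apply: measurable_funM => //; apply: measurable_funX;
      [exact: L2_measurable dal|exact: L2_measurable dzl].
  - apply: aeW => x; have := b_lip (a' x) (a x) (z' x) (z x).
    by rewrite !real_normK ?num_real.
  - by move=> x; rewrite addr_ge0// mulr_ge0// sqr_ge0.
have i1 := integrableZl measurableT c_alpha (L2_integrable_sqr dal).
have i2 := integrableZl measurableT c_z (L2_integrable_sqr dzl).
have i12 := integrableD measurableT i1 i2.
rewrite -(fineK (integrable_fin_num measurableT i12)) lee_fin.
apply: (@le_trans _ _ (c_alpha * D ^+ 2 + c_z * Z ^+ 2)).
  rewrite !norm2_sqrR// -!RintegralZl//; [|exact: L2_integrable_sqr..].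
  by rewrite -RintegralD.
by apply: ler_sqr_sqrtrD => //; exact: norm2_ge0.
Qed.

Hypothesis aA : {ae muI, forall x, A (a x)}.
Hypothesis aA' : {ae muI, forall x, A (a' x)}.
Hypothesis a_min : {ae muI, forall x, forall beta, A beta ->
  J (a x) (z x) <= J beta (z x)}.
Hypothesis a'_min : {ae muI, forall x, forall beta, A beta ->
  J (a' x) (z' x) <= J beta (z' x) + eps x}.

(** The pointwise estimate for approximate minimizers, integrated with the
    Cauchy-Schwarz inequality for the product of the two differences. *)
Lemma action_stability t : 0 < t -> t <= 1 ->
  ell_c * (1 - t) * D ^+ 2 <= ell_J * Z * D + (\int[muI]_x eps x) / t.
Proof.
move=> t0 t1.
have dal : L2 muI (fun x => a' x - a x) by exact: L2B.
have dzl : L2 muI (fun x => z' x - z x) by exact: L2B.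
have pw : {ae muI, forall x, ell_c * (1 - t) * (a' x - a x) ^+ 2 <=
    ell_J * `|(z' x - z x) * (a' x - a x)| + eps x / t}.
  apply: filterS2 (filterI aA aA') (filterI a_min a'_min).
  move=> x [Aax Aax'] [mx mx'].
  rewrite normrM [X in _ <= X + _]mulrA.
  apply: (@strongly_convex_minimizers _ _ Acv (J ^~ (z' x)) (J ^~ (z x))
    (dJ ^~ (z' x)) (dJ ^~ (z x))) => //.
  - by move=> u Au; exact: J_derive.
  - by move=> u Au; exact: J_derive.
  - by move=> u Au; exact: dJ_lip.
  - by move=> u v s Au Av s0 s1; exact: J_convex.
  - by move=> u v s Au Av s0 s1; exact: J_convex.
have iabs := integrable_norm (L2_integrable_mul dzl dal).
have i1 := integrableZl measurableT ell_J iabs.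
have i2 := integrableZl measurableT t^-1 (L2_integrable epsL).
have i3 := integrableZl measurableT (ell_c * (1 - t)) (L2_integrable_sqr dal).
have i12 := integrableD measurableT i1 i2.
have H : \int[muI]_x (ell_c * (1 - t) * (a' x - a x) ^+ 2) <=
   \int[muI]_x (ell_J * `|(z' x - z x) * (a' x - a x)| + t^-1 * eps x).
  apply: (ae_le_Rintegral i3 i12).
  by apply: filterS pw => x; rewrite (mulrC t^-1).
rewrite norm2_sqrR// -RintegralZl//; last exact: L2_integrable_sqr.
apply: le_trans H _.
rewrite RintegralD// !RintegralZl//; last exact: L2_integrable.
rewrite (mulrC t^-1) lerD2r -mulrA ler_wpM2l//.
rewrite -lee_fin; apply: le_trans (cauchy_schwarz_abs dzl dal).
by rewrite /Rintegral fineK// (integrable_fin_num measurableT iabs).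
Qed.
End stability.

(** * Comparison of a finite equilibrium with the graphon equilibrium *)

Lemma mean_sqrt_le (R : realType) (N : nat) (x : 'I_N -> R) : (0 < N)%N ->
  (forall k, 0 <= x k) -> mean (fun k => Num.sqrt (x k)) <= Num.sqrt (mean x).
Proof.
move=> N0 x0; have n0 : 0 < N%:R :> R by rewrite ltr0n.
have m0 : 0 <= mean (fun k => Num.sqrt (x k)).
  by apply: mean_ge0 => k; exact: sqrtr_ge0.
rewrite -(@ler_pXn2r _ 2)// ?nnegrE ?sqrtr_ge0// sqr_sqrtr ?mean_ge0//.
have := @sum_cauchy_schwarz _ _ (fun k => Num.sqrt (x k)) (fun=> 1).
have -> : \sum_(i < N) Num.sqrt (x i) * 1 = N%:R * mean (fun k => Num.sqrt (x k)).
  rewrite /mean mulrA mulfV ?gt_eqF// mul1r.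
  by apply: eq_bigr => k _; rewrite mulr1.
have -> : \sum_(i < N) Num.sqrt (x i) ^+ 2 = N%:R * mean x.
  rewrite /mean mulrA mulfV ?gt_eqF// mul1r.
  by apply: eq_bigr => k _; rewrite sqr_sqrtr.
have -> : \sum_(i < N) 1 ^+ 2 = N%:R :> R.
  by under eq_bigr do rewrite expr1n; rewrite sumr_const card_ord.
have -> : N%:R * mean x * N%:R = N%:R ^+ 2 * mean x by ring.
by rewrite exprMn ler_pM2l// exprn_gt0.
Qed.

Section comparison.
Variables (R : realType) (A : set R) (J dJ : R -> R -> R) (b : R -> R -> R).
Variables (c_alpha c_z c_0 ell_c ell_J ell_Jt : R).
Hypothesis Acv : convex_set (A : set R^o).
Hypotheses (c_alpha0 : 0 <= c_alpha) (c_z0 : 0 <= c_z) (c_00 : 0 <= c_0).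
Hypotheses (ell_c0 : 0 < ell_c) (ell_J0 : 0 <= ell_J) (ell_Jt0 : 0 <= ell_Jt).
Hypothesis b_lip : forall a a' z z', `|b a z - b a' z'| ^+ 2 <=
  c_alpha * `|a - a'| ^+ 2 + c_z * `|z - z'| ^+ 2.
Hypothesis b_bounded : forall a z, `|b a z| <= c_0.
Hypothesis J_derive : forall a z, A a -> is_derive_within A (J ^~ z) a (dJ a z).
Hypothesis J_convex : forall a a' z eps, A a -> A a' -> 0 <= eps -> eps <= 1 ->
  J (eps * a + (1 - eps) * a') z <= eps * J a z + (1 - eps) * J a' z
    - ell_c / 2 * eps * (1 - eps) * `|a - a'| ^+ 2.
Hypothesis dJ_lip : forall a z z', A a -> `|dJ a z' - dJ a z| <= ell_J * `|z' - z|.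
Variables (w : R * R -> R) (a z : R -> R).
Hypotheses (wL : L2 (muI \x muI)%E w) (aL : L2 muI a) (zL : L2 muI z).
Hypothesis zE : {ae muI, forall x, z x = kernel_op muI w (fun y => b (a y) (z y)) x}.
Hypothesis aA : {ae muI, forall x, A (a x)}.
Hypothesis a_min : {ae muI, forall x, forall beta, A beta ->
  J (a x) (z x) <= J beta (z x)}.

Local Notation L := (graphon_opnorm w).
Local Notation s := (Num.sqrt c_z * L).
Local Notation kappa := (ell_J / ell_c * (Num.sqrt c_alpha * L / (1 - s))).
Hypotheses (s1 : s < 1) (kappa1 : kappa < 1).

Variables (N : nat) (W : 'M[R]_N) (al zb r0 B : 'I_N -> R).
Hypothesis N0 : (0 < N)%N.
Hypothesis alA : forall i, A (al i).
Hypothesis zbE : forall k, zb k = mean (fun j => W k j * b (al j) (zb j)) + r0 k.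
Hypothesis B0 : forall i, 0 <= B i.
Hypothesis al_min : forall i beta, A beta ->
  J (al i) (zb i) <= J beta (zb i) + 2 * ell_Jt * Num.sqrt (B i).
Variable phi : R -> R.
Hypothesis mphi : measurable_fun setT phi.
Hypothesis phi_mp : forall S, measurable S -> muI (phi @^-1` S) = muI S.

Local Notation D := (norm2 muI (fun x => step1 al (phi x) - a x)).
Local Notation w' := (fun p : R * R => step2 W (phi p.1, phi p.2)).

(** The stability estimates for the relabelled step functions, with the bound on
    the aggregates inserted into the bound on the actions: the quadratic term
    that comes back has the coefficient [ell_c * kappa]. *)
Lemma equilibrium_distance :
  ell_c * (1 - kappa) / 2 * D ^+ 2 <=
  ell_J / (1 - s) * (c_0 * norm2 (muI \x muI)%E (fun p => w' p - w p) +
    Num.sqrt (mean (fun k => r0 k ^+ 2))) * D +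
  2 * ell_Jt * Num.sqrt (mean B) / ((1 - kappa) / 2).
Proof.
have ev := step1_ae mphi phi_mp N0.
have aL' := L2_step1_mp mphi phi_mp al.
have zL' := L2_step1_mp mphi phi_mp zb.
have rL := L2_step1_mp mphi phi_mp r0.
pose eps i := 2 * ell_Jt * Num.sqrt (B i).
have eL := L2_step1_mp mphi phi_mp eps.
have wL' := L2_step2_mp mphi phi_mp W.
have mb : measurable_fun setT
    (fun y => b (step1 al (phi y)) (step1 zb (phi y))).
  exact: (measurable_fun_lipschitz2 c_alpha0 c_z0 b_lip
    (L2_measurable aL') (L2_measurable zL')).
have bE : {ae muI, forall y, b (step1 al (phi y)) (step1 zb (phi y)) =
    step1 (fun j => b (al j) (zb j)) (phi y)}.
  by apply: filterS ev => y [j E]; rewrite !E.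
have zE' : {ae muI, forall x, step1 zb (phi x) = kernel_op muI w'
    (fun y => b (step1 al (phi y)) (step1 zb (phi y))) x + step1 r0 (phi x)}.
  apply: filterS2 ev (kernel_op_step2_mp mphi phi_mp N0 W mb bE).
  by move=> x [i Ei] ->; rewrite !Ei.
have aA' : {ae muI, forall x, A (step1 al (phi x))}.
  by apply: filterS ev => x [i ->].
have a'_min : {ae muI, forall x, forall beta, A beta ->
    J (step1 al (phi x)) (step1 zb (phi x)) <=
    J beta (step1 zb (phi x)) + step1 eps (phi x)}.
  by apply: filterS ev => x [i E] beta Ab; rewrite !E; exact: al_min.
have k1 : 0 < 1 - kappa by rewrite subr_gt0.
have s10 : 0 < 1 - s by rewrite subr_gt0.
have L0 : 0 <= L by exact: graphon_opnorm_ge0.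
have kappa0 : 0 <= kappa.
  by rewrite !mulr_ge0 ?invr_ge0 ?sqrtr_ge0// ltW.
(* this value of t leaves the coefficient 1 - t - kappa = (1 - kappa) / 2 *)
have t0 : 0 < (1 - kappa) / 2 by rewrite divr_gt0.
have t1 : (1 - kappa) / 2 <= 1 by lra.
have H1 := aggregate_stability c_alpha0 c_z0 c_00 b_lip b_bounded wL wL' aL zL
  aL' zL' rL zE zE'.
have H2 := action_stability Acv ell_J0 J_derive J_convex dJ_lip aL zL aL' zL' eL
  aA aA' a_min a'_min t0 t1.
have -> : Num.sqrt (mean (fun k => r0 k ^+ 2)) =
    norm2 muI (fun x => step1 r0 (phi x)).
  by rewrite -(norm2_step1_mp mphi phi_mp N0) sqrtr_sqr ger0_norm ?norm2_ge0.
have He : \int[muI]_x step1 eps (phi x) <= 2 * ell_Jt * Num.sqrt (mean B).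
  rewrite (Rintegral_step1_mp mphi phi_mp N0 (h := eps) (L2_measurable eL)); last exact: aeW.
  by rewrite /eps meanZ ler_wpM2l ?mulr_ge0// mean_sqrt_le.
move: H1 H2 He.
have [D0 Z0] := (norm2_ge0 muI (fun x => step1 al (phi x) - a x),
  norm2_ge0 muI (fun x => step1 zb (phi x) - z x)).
move: D0 Z0.
set Dn := norm2 muI _; set Zn := norm2 muI (fun x => step1 zb (phi x) - z x).
set eta := norm2 _ (fun p => _); set rho := norm2 muI (fun x => step1 r0 _).
set E := 2 * ell_Jt * _.
move=> D0 Z0 H1 H2 He.
have Zle : Zn <= (c_0 * eta + rho + Num.sqrt c_alpha * L * Dn) / (1 - s).
  by rewrite ler_pdivlMr//; move: H1; lra.
have H3 : ell_J * Zn * Dn <= ell_J / (1 - s) * (c_0 * eta + rho) * Dn +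
    ell_c * kappa * Dn ^+ 2.
  have -> : ell_J / (1 - s) * (c_0 * eta + rho) * Dn + ell_c * kappa * Dn ^+ 2 =
      ell_J * ((c_0 * eta + rho + Num.sqrt c_alpha * L * Dn) / (1 - s)) * Dn.
    by field; rewrite !gt_eqF.
  by rewrite ler_wpM2r// ler_wpM2l.
have He' : (\int[muI]_x step1 eps (phi x)) / ((1 - kappa) / 2) <= E / ((1 - kappa) / 2).
  by rewrite ler_pM2r// invr_gt0.
move: H2 H3 He'; move: (_ / ((1 - kappa) / 2)) (E / _) (ell_J * Zn * Dn)
  (ell_J / (1 - s) * (c_0 * eta + rho) * Dn) => x1 x2 x3 x4.
move: kappa => k; move: (Dn ^+ 2) => D2; lra.
Qed.

End comparison.

(** * Relabellings and graphon aggregates *)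

Lemma cvg_sqrt_div (R : realType) (c : R) : 0 <= c ->
  Num.sqrt (c / n%:R) @[n --> \oo] --> (0 : R).
Proof.
move=> c0; apply: cvg0_sqr.
apply: (@eq_cvgn _ _ (fun n => c / n%:R)).
  by move=> n; rewrite sqr_sqrtr// divr_ge0.
rewrite -(mulr0 c); apply: cvgM; first exact: cvg_cst.
apply/cvgr0Pnorm_lt => e e0; near=> n.
have n0 : 0 < n%:R :> R by rewrite ltr0n; near: n; exact: nbhs_infty_gt.
rewrite ger0_norm ?invr_ge0// invf_plt ?posrE//.
by near: n; exact: nbhs_infty_gtr.
Unshelve. all: by end_near.
Qed.

Lemma mp_bij_mp (R : realType) (phi : R -> R) : mp_bij phi ->
  measurable_fun setT phi /\
  forall S, measurable S -> muI (phi @^-1` S) = muI S.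
Proof. by move=> [psi []]. Qed.

Lemma mp_bij_id (R : realType) : mp_bij (@idfun R).
Proof.
by exists idfun; split; [exact: measurable_id|exact: measurable_id|split|split|].
Qed.

Lemma delta_cut_adherent (R : realType) (u w : R * R -> R) e :
  L2 (muI \x muI)%E u -> L2 (muI \x muI)%E w -> 0 < e ->
  exists2 phi, mp_bij phi &
    cut_norm (fun p => u (phi p.1, phi p.2) - w p) < delta_cut u w + e.
Proof.
move=> uL wL e0.
have hi : has_inf [set cut_norm (fun p => u (phi p.1, phi p.2) - w p) |
    phi in @mp_bij R].
  split.
    exists (cut_norm (fun p => u (idfun p.1, idfun p.2) - w p)).
    by exists idfun => //; exact: mp_bij_id.
  exists 0 => _ [phi /mp_bij_mp[mphi phi_mp] <-]; apply: cut_norm_ge0.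
  by apply: L2B => //; exact: (L2_mp2 mphi phi_mp uL).1.
have [_ [phi phiP <-] h] := inf_adherent e0 hi.
by exists phi.
Qed.

Lemma dist_S_le (R : realType) (a a' : R -> R) phi : mp_bij phi ->
  0 <= dist_S a a' <= norm2 muI (fun x => a (phi x) - a' x).
Proof.
move=> phiP; apply/andP; split.
  apply: lb_le_inf; first by exists (norm2 muI (fun x => a (phi x) - a' x)); exists phi.
  by move=> _ [psi _ <-]; exact: norm2_ge0.
apply: ge_inf; last by exists phi.
by exists 0 => _ [psi _ <-]; exact: norm2_ge0.
Qed.

Section graphon_aggregates.
Variables (R : realType) (A : set R).
Hypotheses (hA0 : A !=set0) (hAclosed : closed A) (hAconvex : convex_set (A : set R^o)).
Variables (b : R -> R -> R) (c_alpha c_z c_0 : R).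
Hypotheses (hc_alpha : 0 <= c_alpha) (hc_z : 0 <= c_z) (hc_0 : 0 < c_0).
Hypothesis hb_lip : forall a a' z z', A a -> A a' ->
     `|b a z - b a' z'| ^+ 2 <=
       c_alpha * `|a - a'| ^+ 2 + c_z * `|z - z'| ^+ 2.
Hypothesis hb_bounded : forall a z, A a -> `|b a z| <= c_0.

(** Off the action set, [b] is composed with a nonexpansive retraction, so that
    measurability and the Lipschitz and boundedness conditions hold everywhere. *)
Lemma exists_extension : exists b' : R -> R -> R,
  [/\ forall a z, A a -> b' a z = b a z,
      forall a a' z z', `|b' a z - b' a' z'| ^+ 2 <=
        c_alpha * `|a - a'| ^+ 2 + c_z * `|z - z'| ^+ 2 &
      forall a z, `|b' a z| <= c_0].
Proof.
have [p [pA pid plip]] := exists_retraction hA0 hAclosed hAconvex.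
exists (fun a z => b (p a) z); split.
- by move=> a z Aa; rewrite pid.
- move=> a a' z z'; apply: le_trans (hb_lip _ _ (pA a) (pA a')) _.
  by rewrite lerD2r ler_wpM2l// ler_pXn2r ?nnegrE.
- by move=> a z; exact: hb_bounded.
Qed.

Variable b' : R -> R -> R.
Hypothesis b'E : forall a z, A a -> b' a z = b a z.
Hypothesis b'_lip : forall a a' z z', `|b' a z - b' a' z'| ^+ 2 <=
        c_alpha * `|a - a'| ^+ 2 + c_z * `|z - z'| ^+ 2.
Hypothesis b'_bounded : forall a z, `|b' a z| <= c_0.

(** The aggregate is chosen among the solutions of its system, so that the
    existence of a solution identifies it with one. *)
Lemma graphon_aggregate_fixed_point (w : R * R -> R) (a : R -> R) :
  L2 (muI \x muI)%E w -> Num.sqrt c_z * graphon_norm2 w < 1 -> admissible A a ->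
  L2 muI (graphon_aggregate b w a) /\
  {ae muI, forall x, graphon_aggregate b w a x =
    kernel_op muI w (fun y => b' (a y) (graphon_aggregate b w a y)) x}.
Proof.
move=> wL small [aL aA].
have ma := L2_measurable aL.
have opE z : measurable_fun setT z ->
    graphon_op w (fun y => b (a y) (z y)) = kernel_op muI w (fun y => b' (a y) (z y)).
  move=> mz; rewrite -graphon_opE.
  - by apply: eq_graphon_op => y Iy; rewrite b'E//; exact: aA.
  - exact: L2_measurable wL.
  - exact: (measurable_fun_lipschitz2 hc_alpha hc_z b'_lip).
have [z zL zE] : exists2 z, L2 muI z &
    {ae muI, forall x, z x = kernel_op muI w (fun y => b' (a y) (z y)) x}.
  apply: (@kernel_fixed_point _ _ R muI w (fun y => b' (a y)) c_0 (Num.sqrt c_z)) => //.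
  - by move=> z mz; exact: (measurable_fun_lipschitz2 hc_alpha hc_z b'_lip).
  - exact: ltW.
  - move=> y z z'; rewrite -(@ler_pXn2r _ 2)// ?nnegrE ?mulr_ge0 ?sqrtr_ge0//.
    rewrite exprMn sqr_sqrtr//; apply: le_trans (b'_lip _ _ _ _) _.
    by rewrite subrr normr0 expr0n/= mulr0 add0r.
have [gL gE] : is_graphon_aggregate b w a (graphon_aggregate b w a).
  apply: xgetPex; exists z; split => //.
  by apply: filterS zE => x zx; rewrite opE//; exact: L2_measurable zL.
split => //; apply: filterS gE => x gx.
by rewrite {1}gx opE//; exact: L2_measurable gL.
Qed.

End graphon_aggregates.

(** * Convergence of equilibria *)

Theorem theorem4p3 (R : realType)
  (A : set R) (hA0 : A !=set0) (hAclosed : closed A)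
  (hAconvex : convex_set (A : set R^o))
  (mu0 : probability R R)
  (hmu0 : mu0.-integrable setT (fun x : R => x%:E))
  (hmu0_mean : (\int[mu0]_x x%:E = 0)%E)
  (b : R -> R -> R) (f : R -> R -> R -> R)
  (dJ : R -> R -> R)
  (c_alpha c_z ell_c ell_J ell_Jt c_0 : R)
  (hc_alpha : 0 <= c_alpha) (hc_z : 0 <= c_z) (hell_c : 0 < ell_c)
  (hell_J : 0 <= ell_J) (hell_Jt : 0 <= ell_Jt) (hc_0 : 0 < c_0)
  (hJt_defined : forall (a : R) (nu : probability (R * R)%type R),
     A a -> calK mu0 nu -> finite_moment2 nu ->
     nu.-integrable setT (EFin \o cost_integrand b f a))
  (hb_lip : forall a a' z z', A a -> A a' ->
     `|b a z - b a' z'| ^+ 2 <=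
       c_alpha * `|a - a'| ^+ 2 + c_z * `|z - z'| ^+ 2)
  (hmu0_moment2 : (\int[mu0]_x (x ^+ 2)%:E < +oo)%E)
  (hJt_lip : forall (a : R) (nu nu' : probability (R * R)%type R), A a ->
     calK mu0 nu -> finite_moment2 nu -> calK mu0 nu' -> finite_moment2 nu' ->
     (`|Jtilde b f a nu' - Jtilde b f a nu|%:E <= ell_Jt%:E * W2 nu nu')%E)
  (hJ_derive : forall a z, A a ->
     is_derive_within A (fun a' => J mu0 b f a' z) a (dJ a z))
  (hdJ_continuous : forall z, {within A, continuous (fun a => dJ a z)})
  (hJ_convex : forall a a' z eps, A a -> A a' -> 0 <= eps -> eps <= 1 ->
     J mu0 b f (eps * a + (1 - eps) * a') z <=
       eps * J mu0 b f a z + (1 - eps) * J mu0 b f a' z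
       - ell_c / 2 * eps * (1 - eps) * `|a - a'| ^+ 2)
  (hdJ_lip : forall a z z', A a -> `|dJ a z' - dJ a z| <= ell_J * `|z' - z|)
  (hb_bounded : forall a z, A a -> `|b a z| <= c_0)
  (W : forall N : nat, 'M[R]_N)
  (hW_sym : forall N, (0 < N)%N -> (W N)^T = W N)
  (d : nat -> measure_display)
  (Omega : forall N : nat, measurableType (d N))
  (P : forall N : nat, probability (Omega N) R)
  (xi : forall N : nat, 'I_N -> {RV (P N) >-> R})
  (hxi : forall N, (0 < N)%N -> iid_law mu0 (xi N))
  (hwell_posed : forall N, (0 < N)%N -> well_posed A b (W N) (xi N))
  (alphaN : forall N : nat, 'I_N -> R)
  (hnash : forall N, (0 < N)%N -> is_nash A b f (W N) (xi N) (alphaN N))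
  (hnash_unique : forall N, (0 < N)%N -> forall a : 'I_N -> R,
     is_nash A b f (W N) (xi N) a -> a = alphaN N)
  (w : R * R -> R) (hw : graphon w)
  (hw_cut : delta_cut (step2 (W N)) w @[N --> \oo] --> (0 : R))
  (hw_norm2 : graphon_norm2 (step2 (W N)) @[N --> \oo] --> graphon_norm2 w)
  (hw_opnorm : graphon_opnorm (step2 (W N)) @[N --> \oo] --> graphon_opnorm w)
  (hw_small2 : Num.sqrt (2 * c_z) * graphon_norm2 w < 1)
  (hw_small : Num.sqrt c_z * graphon_opnorm w < 1)
  (hw_contract : ell_J / ell_c *
     (Num.sqrt c_alpha * graphon_opnorm w /
        (1 - Num.sqrt c_z * graphon_opnorm w)) < 1)
  (alphahat : R -> R)
  (halphahat : is_graphon_nash mu0 A b f w alphahat) :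
  dist_S (step1 (alphaN N)) alphahat @[N --> \oo] --> (0 : R).
Proof.
have c0 : 0 <= c_0 by exact: ltW.
have [b' [b'E b'_lip b'_bounded]] :=
  exists_extension hA0 hAclosed hAconvex hc_alpha hb_lip hb_bounded.
have [wL _] := hw.
have nw0 : 0 <= graphon_norm2 w by exact: norm2_ge0.
have small2 : 2 * c_z * graphon_norm2 w ^+ 2 < 1.
  rewrite -[2 * c_z]sqr_sqrtr ?mulr_ge0// -exprMn expr_lt1//.
  by rewrite mulr_ge0 ?sqrtr_ge0.
have small1 : Num.sqrt c_z * graphon_norm2 w < 1.
  apply: le_lt_trans hw_small2; rewrite ler_wpM2r// ler_sqrt ?mulr_ge0//.
  by rewrite mulr_natl mulr2n lerDl.
have [ahat_adm ahat_min] := halphahat.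
have [zL zE] := graphon_aggregate_fixed_point hc_alpha hc_z hc_0 b'E b'_lip
  b'_bounded wL small1 ahat_adm.
have [ahatL ahatA] := ahat_adm.
have {}ahatA : {ae muI, forall x, A (alphahat x)} by exact: muI_ae.
(* the infimum in the cut distance need not be attained: a slack that tends to 0
   is allowed *)
have /choice[phi phiP] : forall N, exists phi, mp_bij phi /\
    cut_norm (fun p => step2 (W N) (phi p.1, phi p.2) - w p) <
    delta_cut (step2 (W N)) w + N.+1%:R^-1.
  move=> N; have e0 : 0 < N.+1%:R^-1 :> R by rewrite invr_gt0.
  have [phi h1 h2] := delta_cut_adherent (L2_step2 (W N)) wL e0.
  by exists phi.
have phi_mp N := mp_bij_mp (phiP N).1.
pose u N p := step2 (W N) (phi N p.1, phi N p.2).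
have uL N : L2 (muI \x muI)%E (u N).
  by have [mphi mp] := phi_mp N; exact: L2_step2_mp.
have eta0 : norm2 (muI \x muI)%E (fun p => u N p - w p) @[N --> \oo] --> (0 : R).
  apply: cut_norm_strong => //.
  - apply: (@squeeze_cvgr _ _ _ _ (cst 0)
      (fun N => delta_cut (step2 (W N)) w + N.+1%:R^-1)).
    + near=> N; rewrite /= (ltW (phiP N).2) andbT; apply: cut_norm_ge0.
      by apply: L2B => //; exact: uL.
    + exact: cvg_cst.
    + by rewrite -(addr0 (0 : R)); apply: cvgD => //; exact: cvg_harmonic.
  - apply: eq_cvgn hw_norm2 => N; have [mphi mp] := phi_mp N.
    exact: (L2_mp2 mphi mp (L2_step2 (W N))).2.
set s2 := second_moment mu0.
have s20 : 0 <= s2 by exact: second_moment_ge0.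
(* for large N, hs2 (W N) is at most M and 2 * c_z * hs2 (W N) at most theta,
   so that C / N bounds the mean of B below *)
pose M := graphon_norm2 w ^+ 2 + 1.
pose theta := (1 + 2 * c_z * graphon_norm2 w ^+ 2) / 2.
pose S := 4 * c_0 ^+ 2 * M + 2 * s2 * M + 1.
pose C := (12 * c_z * M / (1 - theta) + 6) * S.
have M0 : 0 <= M by rewrite addr_ge0// sqr_ge0.
have theta1 : theta < 1 by rewrite /theta; lra.
have S0 : 0 <= S by rewrite /S !addr_ge0// !mulr_ge0// sqr_ge0.
have C0 : 0 <= C.
  by rewrite mulr_ge0// addr_ge0// divr_ge0 ?mulr_ge0// subr_ge0 ltW.
set L := graphon_opnorm w in hw_small hw_contract.
set s := Num.sqrt c_z * L in hw_small hw_contract.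
set kappa := ell_J / ell_c * _ in hw_contract.
have k1 : 0 < 1 - kappa by rewrite subr_gt0.
have hs2c : hs2 (W N) @[N --> \oo] --> graphon_norm2 w ^+ 2.
  apply: (@near_eq_cvgn _ _ (fun N => graphon_norm2 (step2 (W N)) * graphon_norm2 (step2 (W N)))).
    near=> N; rewrite -expr2 norm2_step2//.
    by near: N; exact: nbhs_infty_gt.
  by rewrite expr2; exact: cvgM.
apply/cvgr0Pnorm_lt => e e0.
pose g := ell_c * (1 - kappa) / 2.
have g0 : 0 < g by rewrite /g divr_gt0// mulr_gt0.
pose p N := ell_J / (1 - s) * (c_0 * norm2 (muI \x muI)%E (fun q => u N q - w q) +
  Num.sqrt ((s2 * M + 1) / N%:R)).
pose q N := 2 * ell_Jt / ((1 - kappa) / 2) * Num.sqrt (C / N%:R).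
have pc : p N @[N --> \oo] --> (0 : R).
  have -> : 0 = ell_J / (1 - s) * (c_0 * 0 + 0) :> R by rewrite mulr0 addr0 mulr0.
  apply: cvgM; first exact: cvg_cst.
  apply: cvgD; first by apply: cvgM => //; exact: cvg_cst.
  by apply: cvg_sqrt_div; rewrite addr_ge0// mulr_ge0.
have qc : q N @[N --> \oo] --> (0 : R).
  rewrite -(mulr0 (2 * ell_Jt / ((1 - kappa) / 2))).
  by apply: cvgM; [exact: cvg_cst|exact: cvg_sqrt_div].
near=> N.
have N0 : (0 < N)%N by near: N; exact: nbhs_infty_gt.
have hsM : hs2 (W N) <= M.
  by near: N; apply: (cvgr_le _ hs2c); rewrite /M ltrDl.
have hst : 2 * c_z * hs2 (W N) <= theta.
  near: N; have c2 : 2 * c_z * hs2 (W N) @[N --> \oo] --> 2 * c_z * graphon_norm2 w ^+ 2.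
    by apply: cvgM => //; exact: cvg_cst.
  by apply: (cvgr_le _ c2); rewrite /theta; lra.
have pe : p N <= g * (e / 4).
  by near: N; apply: (cvgr_le _ pc); rewrite mulr_gt0// divr_gt0.
have qe : q N <= g * (e ^+ 2 / 4).
  by near: N; apply: (cvgr_le _ qc); rewrite mulr_gt0// divr_gt0// exprn_gt0.
have n0 : 0 < N%:R :> R by rewrite ltr0n.
have h0 := hs2_ge0 (W N).
have b_lip a z z' : A a -> (b a z - b a z') ^+ 2 <= c_z * (z - z') ^+ 2.
  move=> Aa; have := hb_lip a a z z' Aa Aa.
  by rewrite subrr normr0 expr0n/= mulr0 add0r !real_normK ?num_real.
have [zb [r0 [B [zbE r0le B0 Ble al_min]]]] := finite_nash_approx hmu0 hmu0_mean
  hmu0_moment2 hc_z c0 b_lip hb_bounded hell_Jt hJt_lip N0 (hxi N N0)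
  (hwell_posed N N0) (hnash N N0) (le_lt_trans hst theta1).
have alA i : A (alphaN N i) by exact: (hnash N N0).1.
have zbE' k : zb k = mean (fun j => W N k j * b' (alphaN N j) (zb j)) + r0 k.
  rewrite {1}zbE; congr (_ + _); congr mean.
  by apply/funext => j; rewrite b'E.
have [mphi mp] := phi_mp N.
have H := equilibrium_distance hAconvex hc_alpha hc_z c0 hell_c hell_J hell_Jt
  b'_lip b'_bounded hJ_derive hJ_convex hdJ_lip wL ahatL zL zE ahatA ahat_min
  hw_small hw_contract N0 alA zbE' B0 al_min mphi mp.
have /andP[d0 dle] := dist_S_le (step1 (alphaN N)) alphahat (phiP N).1.
rewrite ger0_norm//; apply: le_lt_trans dle _.
apply: (quadratic_small g0 e0 _ pe qe (norm2_ge0 _ _)).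
apply: le_trans H _.
have s10 : 0 < 1 - s by rewrite subr_gt0.
apply: lerD.
  rewrite ler_wpM2r ?norm2_ge0// /p ler_wpM2l ?divr_ge0 ?(ltW s10)//.
  rewrite lerD2l ler_sqrt; last by rewrite divr_ge0 ?ler0n// addr_ge0// mulr_ge0.
  apply: le_trans r0le _; rewrite ler_pM2r ?invr_gt0// lerD2r.
  by rewrite ler_wpM2l.
rewrite /q [leRHS]mulrAC ler_pM2r; last by rewrite invr_gt0 divr_gt0.
rewrite ler_wpM2l ?mulr_ge0// ler_sqrt ?divr_ge0 ?ler0n//.
apply: le_trans Ble _; rewrite ler_pM2r ?invr_gt0// /C.
have hst1 : 0 < 1 - 2 * c_z * hs2 (W N) by rewrite subr_gt0 (le_lt_trans hst).
have th1 : 0 < 1 - theta by rewrite subr_gt0.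
apply: ler_pM.
- apply: addr_ge0 => //; apply: divr_ge0; last exact: ltW.
  by apply: mulr_ge0 => //; exact: mulr_ge0.
- by repeat first [done | exact: sqr_ge0 | apply: addr_ge0 | apply: mulr_ge0].
- rewrite lerD2r; apply: ler_pM.
  + by repeat first [done | apply: mulr_ge0].
  + by rewrite invr_ge0 ltW.
  + by rewrite ler_wpM2l// mulr_ge0.
  + by rewrite lef_pV2 ?posrE// lerD2l lerN2.
- rewrite /S lerD2r; apply: lerD; rewrite ler_wpM2l//;
    by repeat first [done | exact: sqr_ge0 | apply: mulr_ge0].
Unshelve. all: by end_near.
Qed.
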